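(* Let $T\subset\mathbb R^3$ be a $\mathbb T$ set centered at the origin, let $C$ be the associated regular tetrahedron, and let $\epsilon_1,\epsilon_2>0$ be the constants described in the context. Let $E$ be a reduced 2-dimensional Almgren-minimal set in $\mathbb R^3$ such that 1) $d_{0,2}(E,T)<\min\{\epsilon_1,\epsilon_2\}$; 2) $E$ does not contain any point of type $\mathbb T$. Let $\Omega_1,\dots,\Omega_4$ be the four connected components of $\partial C\setminus E$ described in the context. Then there exists no deformation $f$ of $E$ in $C$ such that $C\setminus f(E)$ contains a segment $[x,y]$ connecting two different $\Omega_i$, i.e. with $x\in\Omega_i$, $y\in\Omega_j$ for some $1\le i\neq j\le 4$.
   Context: $H^2$ is 2-dimensional Hausdorff measure; $[x,y]$ is the segment with endpoints $x,y$; $B(x,r)$ is the open ball. Almgren minimality: a closed set $E\subset\mathbb R^3$ is (2-dimensional) Almgren-minimal if $H^2(E\cap B)<\infty$ for every compact ball $B$, and $H^2(E\setminus F)\le H^2(F\setminus E)$ for every $F=\varphi(E)$ closed, where $\varphi:\mathbb R^3\to\mathbb R^3$ is Lipschitz and there is a compact ball $B$ with $\varphi=\mathrm{id}$ outside $B$ and $\varphi(B)\subset B$. Such a $\varphi$ is called a deformation in $B$; a deformation in $C$ is defined in the same way with $B$ replaced by $C$ (Lipschitz map, identity outside $C$, sending $C$ into $C$). $E$ is reduced if $H^2(E\cap B(x,r))>0$ for all $x\in E$, $r>0$. Relative distance: $d_{x,r}(E,F)=\frac1r\max\{\sup\{d(y,F):y\in E\cap B(x,r)\},\sup\{d(y,E):y\in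 F\cap B(x,r)\}\}$. A $\mathbb Y$ set is a union of three closed half planes with a common boundary line, meeting along that line with $120^\circ$ angles. A $\mathbb T$ set centered at the origin is the cone over the 1-skeleton of a regular tetrahedron centered at $0$. A blow-up limit of $E$ at $x$ is a limit (local Hausdorff convergence) of $r_k^{-1}(E-x)$ for a sequence $r_k\to0^+$. A point $x\in E$ is of type $\mathbb T$ (resp. $\mathbb Y$) if some blow-up limit of $E$ at $x$ is a $\mathbb T$ set (resp. a $\mathbb Y$ set). Notation attached to $T$: $y_1,\dots,y_4$ are the four points of type $\mathbb Y$ of $T\cap\partial B(0,1)$; $C$ is the convex hull of $\{y_1,\dots,y_4\}$, a (solid) regular tetrahedron inscribed in $B(0,1)$; $T_C=T\cap C$. One has $\frac12H^2(\partial C)=\frac43\sqrt3<2\sqrt2=H^2(T_C)$, and $\delta=\frac14\big(H^2(T_C)-\frac12H^2(\partial C)\big)$. Constants: $\epsilon_1,\epsilon_2>0$ are small constants (they exist by known regularity results) such that for every reduced Almgren-minimal set $E$ with $d_{0,2}(E,T)<\min\{\epsilon_1,\epsilon_2\}$: (a) $H^2(E\cap C)>H^2(T_C)-\delta$; (b) in $B(0,\frac32)\setminus B(0,\frac12)$, $E$ is the image of $T$ under a $C^1$ diffeomorphism whose derivative is very near the identity; consequently $E\cap\partial C$ has the same topology as $T\cap\partial C$: it consists of six piecewise $C^1$ curves $w_{ij}$, $1\le i<j\le4$, meeting by three at four points $b_1,\dots,b_4$, where $b_i$ is very near $y_i$ and $w_{ij}$ joins $b_i$ to $b_j$ and is very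 near $[b_i,b_j]$; (c) denoting by $\Omega_i$, $1\le i\le4$, the connected component of $\partial C\setminus E$ opposite to $b_i$, i.e. bounded by the three curves $w_{kl}$ with $k,l\ne i$, one has $H^2(\Omega_i)>\frac14H^2(\partial C)-\delta$ for each $i$. *)

(* Defs.v *)
From HB Require Import structures.
From mathcomp Require Import all_boot all_order all_algebra.
From mathcomp Require Import all_classical all_reals all_analysis.

Set Implicit Arguments.
Unset Strict Implicit.
Unset Printing Implicit Defensive.

Import Order.TTheory GRing.Theory Num.Theory.
Import numFieldNormedType.Exports.

Local Open Scope classical_set_scope.
Local Open Scope ring_scope.

(* The library norm of 'rV[R]_3 is the sup norm.  It is used only through
   notions that do not depend on the choice of a norm: topology,
   differentiability and Lipschitz maps without a specified constant.  All
   metric quantities are computed with the Euclidean norm [enorm]. *)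
Notation pt R := 'rV[R]_3.

Section Geometry.
Context {R : realType}.
Implicit Types (x y c : pt R) (A E F : set (pt R)).

Definition dot x y : R := \sum_i x 0 i * y 0 i.
Definition enorm x : R := Num.sqrt (dot x x).

Definition open_ball c (r : R) : set (pt R) := [set x | enorm (x - c) < r].
Definition compact_ball c (r : R) : set (pt R) := [set x | enorm (x - c) <= r].

Definition segment x y : set (pt R) :=
  [set (1 - t) *: x + t *: y | t in [set t : R | 0 <= t <= 1]].

Definition bdry A : set (pt R) := closure A `\` interior A.

Definition convex_hull A : set (pt R) := smallest (@convex_set R (pt R)) A.

(* The added [0] makes the diameter of the empty set 0 instead of -oo. *)
Definition ediam A : \bar R :=
  ereal_sup ([set 0%E] `|` [set (enorm (p.1 - p.2))%:E | p in A `*` A]).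

(* The factor pi / 4 is the normalization for which H^2 is the area on planes. *)
Definition hausdorff2_delta (d : R) A : \bar R :=
  ereal_inf [set (\sum_(0 <= k <oo) ((pi / 4)%:E * ediam (U k) ^+ 2))%E |
    U in [set U : (set (pt R))^nat |
      A `<=` \bigcup_k U k /\ forall k, (ediam (U k) <= d%:E)%E]].

Definition H2 A : \bar R :=
  ereal_sup [set hausdorff2_delta d A | d in [set d : R | 0 < d]].

(* Equal to +oo when F is empty. *)
Definition set_dist x F : \bar R := ereal_inf [set (enorm (x - z))%:E | z in F].

Definition excess x (r : R) E F : \bar R :=
  ereal_sup ([set 0%E] `|` [set set_dist y F | y in E `&` open_ball x r]).

Definition drel x (r : R) E F : \bar R :=
  ((r^-1)%:E * maxe (excess x r E F) (excess x r F E))%E.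

Definition local_hausdorff_cvg (Ek : (set (pt R))^nat) F : Prop :=
  forall r : R, 0 < r -> (fun k => drel 0 r (Ek k) F) @ \oo --> 0%E.

Definition deformation (D : set (pt R)) (f : pt R -> pt R) : Prop :=
  [/\ lipschitz f, forall x, ~ D x -> f x = x & f @` D `<=` D].

Definition almgren_minimal E : Prop :=
  [/\ closed E,
      forall c (r : R), 0 < r -> (H2 (E `&` compact_ball c r) < +oo)%E &
      forall c (r : R) f, 0 < r -> deformation (compact_ball c r) f ->
        closed (f @` E) ->
        (H2 (E `\` f @` E) <= H2 (f @` E `\` E))%E].

Definition reduced E : Prop :=
  forall x (r : R), E x -> 0 < r -> (0 < H2 (E `&` open_ball x r))%E.

Definition half_plane p u e : set (pt R) :=
  [set x | exists s t : R, 0 <= t /\ x = p + s *: u + t *: e].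

Definition Y_set F : Prop :=
  exists p u (e : 'I_3 -> pt R),
    [/\ enorm u = 1,
        forall i, enorm (e i) = 1 /\ dot u (e i) = 0,
        forall i j, i != j -> dot (e i) (e j) = - (1 / 2) &
        F = \bigcup_i half_plane p u (e i)].

Definition regular_tetrahedron0 (v : 'I_4 -> pt R) : Prop :=
  \sum_i v i = 0 /\
  exists2 l : R, 0 < l & forall i j, i != j -> enorm (v i - v j) = l.

Definition skeleton1 (v : 'I_4 -> pt R) : set (pt R) :=
  [set x | exists i j, i != j /\ segment (v i) (v j) x].

Definition cone A : set (pt R) :=
  [set x | exists t z, [/\ 0 <= t :> R, A z & x = t *: z]].

Definition T_set F : Prop :=
  exists2 v, regular_tetrahedron0 v & F = cone (skeleton1 v).

Definition blow_up_limit E x F : Prop :=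
  exists rk : R^nat,
    [/\ forall k, 0 < rk k, rk @ \oo --> 0 &
        local_hausdorff_cvg (fun k => [set (rk k)^-1 *: (y - x) | y in E]) F].

Definition type_Y E x : Prop := E x /\ exists2 F, Y_set F & blow_up_limit E x F.
Definition type_T E x : Prop := E x /\ exists2 F, T_set F & blow_up_limit E x F.

Definition Y_points T : set (pt R) := [set x | type_Y T x /\ enorm x = 1].

Definition solid T : set (pt R) := convex_hull (Y_points T).

Definition delta T : \bar R :=
  ((4^-1)%:E * (H2 (T `&` solid T) - (2^-1)%:E * H2 (bdry (solid T))))%E.

Definition C1_map (f : pt R -> pt R) : Prop :=
  (forall x, differentiable f x) /\ continuous (jacobian f).

Definition C1_diffeo (f : pt R -> pt R) : Prop :=
  C1_map f /\ exists g, [/\ C1_map g, cancel f g & cancel g f].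

Definition C1_curve (g : R -> pt R) : Prop :=
  (forall t, derivable g t 1) /\ continuous (derive1 g).

(* A map that is C^1 on a compact interval, up to the endpoints, is the
   restriction of a C^1 map of the whole line. *)
Definition piecewise_C1 (w : R -> pt R) : Prop :=
  exists2 s : seq R, itv_partition 0 1 s &
    forall k, (k < size s)%N -> exists2 g, C1_curve g &
      forall t, nth 0 (0 :: s) k <= t <= nth 0 (0 :: s) k.+1 -> w t = g t.

Definition arc (w : R -> pt R) : set (pt R) :=
  w @` [set t : R | 0 <= t <= 1].

(* In the shell, E is the image of T by a diffeomorphism whose derivative is
   eta-close to the identity in operator norm. *)
Definition C1_near_in_shell (eta : R) T E : Prop :=
  let shell := open_ball 0 (3 / 2) `\` open_ball 0 (1 / 2) in
  exists f, [/\ C1_diffeo f,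
    forall x v, enorm ('d f x v - v) <= eta * enorm v &
    E `&` shell = (f @` T) `&` shell].

(* E meets the boundary of [solid T] along six simple arcs w i j, i < j, that
   meet only at their endpoints b i, so that this set is homeomorphic to the
   1-skeleton of a tetrahedron; eta quantifies "very near".  The values of
   w i j for j <= i are irrelevant. *)
Record trace_graph (eta : R) T (y : 'I_4 -> pt R) E (b : 'I_4 -> pt R)
    (w : 'I_4 -> 'I_4 -> R -> pt R) : Prop := TraceGraph {
  trace_cover : E `&` bdry (solid T) =
    [set x | exists i j : 'I_4, (i < j)%N /\ arc (w i j) x];
  trace_node_inj : injective b;
  trace_node_near : forall i, enorm (b i - y i) <= eta;
  trace_arc_C1 : forall i j : 'I_4, (i < j)%N -> piecewise_C1 (w i j);
  trace_arc_simple : forall (i j : 'I_4) (s t : R), (i < j)%N ->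
    0 <= s <= 1 -> 0 <= t <= 1 -> w i j s = w i j t -> s = t;
  trace_arc_ends : forall i j : 'I_4, (i < j)%N ->
    w i j 0 = b i /\ w i j 1 = b j;
  trace_arc_near : forall i j : 'I_4, (i < j)%N ->
    (forall x, arc (w i j) x -> (set_dist x (segment (b i) (b j)) <= eta%:E)%E) /\
    (forall x, segment (b i) (b j) x -> (set_dist x (arc (w i j)) <= eta%:E)%E);
  trace_arc_meet : forall i j k l : 'I_4, (i < j)%N -> (k < l)%N ->
    (i, j) != (k, l) ->
    arc (w i j) `&` arc (w k l) =
      b @` [set m | m \in [:: i; j] /\ m \in [:: k; l]]
}.

(* A component Omega i of [bdry (solid T) `\` E] is relatively open in
   [bdry (solid T)], so [closure (Omega i) `\` Omega i] is its relative
   boundary. *)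
Definition trace_faces T E (w : 'I_4 -> 'I_4 -> R -> pt R)
    (Omega : 'I_4 -> set (pt R)) : Prop :=
  [/\ bdry (solid T) `\` E = \bigcup_i Omega i,
      forall i, exists2 x, (bdry (solid T) `\` E) x &
        Omega i = connected_component (bdry (solid T) `\` E) x &
      forall i, closure (Omega i) `\` Omega i =
        [set x | exists k l : 'I_4,
          [/\ (k < l)%N, k != i, l != i & arc (w k l) x]]].

(* The properties (a), (b), (c) of the regularity constants eps1 and eps2. *)
Definition regularity_constants (eta : R) T (y : 'I_4 -> pt R)
    (eps1 eps2 : R) : Prop :=
  forall E, reduced E -> almgren_minimal E ->
    (drel 0 2 E T < (Num.min eps1 eps2)%:E)%E ->
    [/\ (H2 (T `&` solid T) - delta T < H2 (E `&` solid T))%E,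
        C1_near_in_shell eta T E,
        exists b w Omega, trace_graph eta T y E b w /\ trace_faces T E w Omega &
        forall b w Omega,
          trace_graph eta T y E b w -> trace_faces T E w Omega ->
          forall i,
            ((4^-1)%:E * H2 (bdry (solid T)) - delta T < H2 (Omega i))%E].

End Geometry.

(* Main.v *)
Require Import Defs.
From HB Require Import structures.
From mathcomp Require Import all_boot all_order all_algebra.
From mathcomp Require Import all_classical all_reals all_analysis.
From mathcomp Require Import ring lra.
Import Order.TTheory GRing.Theory Num.Theory.
Import numFieldNormedType.Exports.
Local Open Scope classical_set_scope.
Local Open Scope ring_scope.

Set Implicit Arguments.
Unset Strict Implicit.
Unset Printing Implicit Defensive.

(* If the image of E under f leaves room for a segment [p, q] joining two faces
   Omega i and Omega j, then [p, q] meets the interior of the tetrahedron C at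
   some m, and the radial projection from m pushes the image of E inside C onto
   the boundary of C, away from p and q. Since each face is connected, a finite
   chain of small Lipschitz pushes along the boundary, started near p and near
   q, then empties Omega i and Omega j up to an arbitrarily small area. The
   resulting competitor has inside C at most the area of E on the boundary plus
   that of the two other faces, which is less than H2(T_C) - delta because
   delta >= 0: this contradicts H2(E & C) > H2(T_C) - delta.
   The area comparison behind delta >= 0 uses no exact value: each face of C is
   covered by the orthogonal projections of the parts of the sectors of T lying
   nearest to it, and a generic point of T_C belongs to two such parts. *)

(** * Euclidean norm and Lipschitz maps *)

(** The two faces cannot simply be retracted onto their boundary curves. A competitor has to be the
    image of [E] under a single Lipschitz map of the whole space that leaves in place the part of
    [E] outside [C], and a Lipschitz retraction would require a fine control of the curves. For this
    reason the faces are emptied only on compact subsets, and every push is confined to a region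
    free of [E]. No push needs an area estimate: the image of [E] inside [C] stays in the boundary
    of [C], and the points displaced there land on planes through the origin, which cut that
    boundary in null sets, so that inclusions of sets suffice. Since [H2] is only an outer measure,
    summing the areas of the faces rests on the Caratheodory property of closed sets. *)

Section Euclidean.
Context {R : realType}.
Implicit Types x y z : pt R.

Lemma dotC x y : dot x y = dot y x.
Proof. by apply: eq_bigr => i _; rewrite mulrC. Qed.

Lemma dotDl x y z : dot (x + y) z = dot x z + dot y z.
Proof. by rewrite /dot -big_split; apply: eq_bigr => i _; rewrite mxE mulrDl. Qed.

Lemma dotZl (a : R) x y : dot (a *: x) y = a * dot x y.
Proof. by rewrite /dot mulr_sumr; apply: eq_bigr => i _; rewrite mxE mulrA. Qed.

Lemma dotDr x y z : dot x (y + z) = dot x y + dot x z.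
Proof. by rewrite dotC dotDl !(dotC x). Qed.

Lemma dotZr (a : R) x y : dot x (a *: y) = a * dot x y.
Proof. by rewrite dotC dotZl dotC. Qed.

Lemma dotNl x y : dot (- x) y = - dot x y.
Proof. by rewrite -scaleN1r dotZl mulN1r. Qed.

Lemma dotNr x y : dot x (- y) = - dot x y.
Proof. by rewrite dotC dotNl dotC. Qed.

Lemma dotBl x y z : dot (x - y) z = dot x z - dot y z.
Proof. by rewrite dotDl dotNl. Qed.

Lemma dotBr x y z : dot x (y - z) = dot x y - dot x z.
Proof. by rewrite dotDr dotNr. Qed.

Lemma dot0l x : dot 0 x = 0.
Proof. by rewrite -(scale0r x) dotZl mul0r. Qed.

Lemma dot0r x : dot x 0 = 0.
Proof. by rewrite dotC dot0l. Qed.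

Lemma dot_suml (I : Type) (r : seq I) (P : pred I) (F : I -> pt R) x :
  dot (\sum_(i <- r | P i) F i) x = \sum_(i <- r | P i) dot (F i) x.
Proof.
by elim/big_rec2: _ => [|i a b _ <-]; rewrite ?dot0l ?dotDl.
Qed.

Lemma dot_sumr (I : Type) (r : seq I) (P : pred I) (F : I -> pt R) x :
  dot x (\sum_(i <- r | P i) F i) = \sum_(i <- r | P i) dot x (F i).
Proof. by rewrite dotC dot_suml; apply: eq_bigr => i _; rewrite dotC. Qed.

Definition dotE := (dotDl, dotDr, dotNl, dotNr, dotZl, dotZr, dot0l, dot0r).

Lemma dot_ge0 x : 0 <= dot x x.
Proof. by apply: sumr_ge0 => i _; rewrite -expr2 sqr_ge0. Qed.

Lemma dot_eq0 x : dot x x = 0 -> x = 0.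
Proof.
move/eqP; rewrite psumr_eq0 => [|i _]; last by rewrite -expr2 sqr_ge0.
move/allP => x0; apply/rowP => i; rewrite mxE.
by have := x0 i; rewrite mem_index_enum => /(_ isT); rewrite mulf_eq0 orbb => /eqP.
Qed.

Lemma enorm_ge0 x : 0 <= enorm x.
Proof. exact: sqrtr_ge0. Qed.

Lemma enorm_sqr x : enorm x ^+ 2 = dot x x.
Proof. by rewrite sqr_sqrtr ?dot_ge0. Qed.

Lemma enorm0 : enorm (0 : pt R) = 0.
Proof. by rewrite /enorm dot0l sqrtr0. Qed.

Lemma enorm_eq0 x : enorm x = 0 -> x = 0.
Proof. by move=> x0; apply: dot_eq0; rewrite -enorm_sqr x0 expr0n. Qed.

Lemma enorm_gt0 x : x <> 0 -> 0 < enorm x.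
Proof.
by move=> x0; rewrite lt_neqAle enorm_ge0 andbT eq_sym; apply/eqP => /enorm_eq0.
Qed.

Lemma enormZ (a : R) x : enorm (a *: x) = `|a| * enorm x.
Proof.
rewrite /enorm dotZl dotZr mulrA -expr2 sqrtrM ?sqr_ge0 //.
by rewrite sqrtr_sqr.
Qed.

Lemma enormN x : enorm (- x) = enorm x.
Proof. by rewrite -scaleN1r enormZ normrN1 mul1r. Qed.

Lemma enormB x y : enorm (x - y) = enorm (y - x).
Proof. by rewrite -enormN opprB. Qed.

Lemma cauchy_schwarz x y : dot x y <= enorm x * enorm y.
Proof.
have [->|/eqP x0] := eqVneq x 0; first by rewrite dot0l enorm0 mul0r.
have [->|/eqP y0] := eqVneq y 0; first by rewrite dot0r enorm0 mulr0.
have nx := enorm_gt0 x0; have ny := enorm_gt0 y0.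
have := dot_ge0 (enorm y *: x - enorm x *: y).
rewrite !dotE -!enorm_sqr (dotC y x) => h.
have : 0 <= 2 * (enorm x * enorm y) * (enorm x * enorm y - dot x y).
  move: h; rewrite [X in 0 <= X -> _](_ : _ =
    2 * (enorm x * enorm y) * (enorm x * enorm y - dot x y))//; ring.
by rewrite pmulr_rge0 ?subr_ge0// !mulr_gt0.
Qed.

Lemma normr_dot_le x y : `|dot x y| <= enorm x * enorm y.
Proof.
by rewrite ler_norml cauchy_schwarz andbT lerNl -dotNl -(enormN x) cauchy_schwarz.
Qed.

Lemma enormD x y : enorm (x + y) <= enorm x + enorm y.
Proof.
rewrite -(@ler_pXn2r _ 2)// ?nnegrE ?addr_ge0 ?enorm_ge0//.
rewrite enorm_sqr !dotE sqrrD -!enorm_sqr (dotC y x).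
by have := cauchy_schwarz x y; lra.
Qed.

Lemma enormBD y x z : enorm (x - z) <= enorm (x - y) + enorm (y - z).
Proof. by have := enormD (x - y) (y - z); rewrite addrA subrK. Qed.

Lemma coord_le_enorm x i : `|x 0 i| <= enorm x.
Proof.
rewrite -sqrtr_sqr ler_wsqrtr// /dot (bigD1 i)//= -expr2 lerDl.
by apply: sumr_ge0 => j _; rewrite -expr2 sqr_ge0.
Qed.

Lemma norm_le_enorm x : `|x| <= enorm x.
Proof.
rewrite /Num.norm/= mx_normrE bigmax_le ?enorm_ge0// => -[i j] _ /=.
by rewrite (ord1 i) coord_le_enorm.
Qed.

Lemma enorm_le_norm x : enorm x <= 2 * `|x|.
Proof.
have xi i : `|x 0 i| <= `|x|.
  by rewrite {2}/Num.norm/= mx_normrE; apply: (le_bigmax _ _ (0, i)).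
rewrite -(@ler_pXn2r _ 2)// ?nnegrE ?mulr_ge0 ?enorm_ge0//.
rewrite enorm_sqr /dot (@le_trans _ _ (\sum_(i < 3) `|x| ^+ 2))//.
  apply: ler_sum => i _; rewrite -expr2 -real_normK ?num_real//.
  by rewrite ler_pXn2r ?nnegrE.
by rewrite sumr_const card_ord exprMn -mulr_natl; have := sqr_ge0 `|x|; lra.
Qed.

Lemma nbhs_enormP x (A : set (pt R)) :
  nbhs x A <-> exists2 r : R, 0 < r & forall z, enorm (z - x) < r -> A z.
Proof.
split=> [/nbhs_ballP[r r0 xA]|[r r0 xA]].
  exists r => // z zx; apply: xA; rewrite -ball_normE /ball_/=.
  by rewrite (le_lt_trans _ zx)// enormB norm_le_enorm.
apply/nbhs_ballP; exists (r / 2) => /=; first by rewrite divr_gt0.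
move=> z; rewrite -ball_normE /ball_/= => zx; apply: xA.
by rewrite enormB (le_lt_trans (enorm_le_norm _))// -ltr_pdivlMl// mulrC.
Qed.

Lemma open_enormP (A : set (pt R)) : open A <->
  forall x, A x -> exists2 r : R, 0 < r & forall z, enorm (z - x) < r -> A z.
Proof.
rewrite openE; split=> [Ao x /Ao/nbhs_enormP//|h x /h].
by move=> /nbhs_enormP.
Qed.

Lemma closed_far (A : set (pt R)) x : closed A -> ~ A x ->
  exists2 r : R, 0 < r & forall z, A z -> r <= enorm (z - x).
Proof.
move=> cA nAx.
have /open_enormP/(_ x nAx)[r r0 xr] : open (~` A) by exact: closed_openC.
by exists r => // z Az; rewrite leNgt; apply/negP => /xr.
Qed.

Lemma bounded_closed_compact_enorm (A : set (pt R)) (M : R) : closed A ->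
  (forall x, A x -> enorm x <= M) -> compact A.
Proof.
move=> cA bA; apply: bounded_closed_compact => //.
exists M; split; first exact: num_real.
by move=> r Mr x /bA xM /=; rewrite (le_trans (norm_le_enorm _))// (le_trans xM)// ltW.
Qed.

Definition elip (f : pt R -> pt R) :=
  exists2 L : R, 0 <= L & forall x y, enorm (f x - f y) <= L * enorm (x - y).

Definition slip (f : pt R -> R) :=
  exists2 L : R, 0 <= L & forall x y, `|f x - f y| <= L * enorm (x - y).

Lemma elipP f : lipschitz f <-> elip f.
Proof.
split=> [[M [_ hM]]|[L L0 hL]].
  pose N := `|M| + 1; have N0 : 0 <= N by rewrite addr_ge0.
  exists (2 * N) => [|x y]; first by rewrite mulr_ge0.
  have /hM/(_ (x, y))/= : M < N by rewrite (le_lt_trans (ler_norm M))// ltrDl.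
  move=> /(_ (conj I I)) h; rewrite (le_trans (enorm_le_norm _))//.
  rewrite -mulrA ler_wpM2l// (le_trans h)// ler_wpM2l//.
  exact: norm_le_enorm.
apply: (@klipschitzW _ _ _ (L * 2)); first exact: (@globally_properfilter _ _ (0, 0)).
move=> [x y] _ /=; rewrite (le_trans (norm_le_enorm _))// (le_trans (hL _ _))//.
by rewrite -mulrA ler_wpM2l// enorm_le_norm.
Qed.

Lemma elip_continuous f : elip f -> continuous f.
Proof.
move=> [L L0 hL] x A /nbhs_enormP[r r0 fxA]; apply/nbhs_enormP.
exists (r / (L + 1)) => [|z zx]; first by rewrite divr_gt0// ltr_wpDl.
apply: fxA; rewrite (le_lt_trans (hL _ _))//.
move: zx; rewrite ltr_pdivlMr ?ltr_wpDl// => zx.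
by have := enorm_ge0 (z - x); nra.
Qed.

Lemma slip_continuous f : slip f -> continuous f.
Proof.
move=> [L L0 hL] x A /nbhs_ballP[r r0 fxA]; apply/nbhs_enormP.
exists (r / (L + 1)) => [|z zx]; first by rewrite divr_gt0// ltr_wpDl.
apply: fxA; rewrite /ball/= distrC (le_lt_trans (hL _ _))//.
move: zx; rewrite ltr_pdivlMr ?ltr_wpDl// => zx.
by have := enorm_ge0 (z - x); nra.
Qed.

Lemma slip_dot (a : pt R) : slip (dot a).
Proof.
by exists (enorm a); [exact: enorm_ge0|move=> x y; rewrite -dotBr normr_dot_le].
Qed.

Lemma continuous_dot (a : pt R) : continuous (dot a).
Proof. exact/slip_continuous/slip_dot. Qed.

Lemma elip_id : elip (@id (pt R)).
Proof. by exists 1 => // x y; rewrite mul1r. Qed.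

Lemma elip_comp f g : elip f -> elip g -> elip (f \o g).
Proof.
move=> [L L0 hL] [K K0 hK]; exists (L * K); first by rewrite mulr_ge0.
by move=> x y; rewrite (le_trans (hL _ _))// -mulrA ler_wpM2l.
Qed.

Lemma elipD f g : elip f -> elip g -> elip (f \+ g).
Proof.
move=> [L L0 hL] [K K0 hK]; exists (L + K); first by rewrite addr_ge0.
move=> x y; rewrite /= opprD addrACA (le_trans (enormD _ _))// mulrDl.
by rewrite lerD.
Qed.

Lemma elipN f : elip f -> elip (fun x => - f x).
Proof.
by move=> [L L0 hL]; exists L => // x y; rewrite -opprD enormN.
Qed.

Lemma elip_scale_const f (v : pt R) : slip f -> elip (fun x => f x *: v).
Proof.
move=> [L L0 hL]; exists (L * enorm v); first by rewrite mulr_ge0// enorm_ge0.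
move=> x y; rewrite -scalerBl enormZ mulrAC ler_wpM2r ?enorm_ge0//.
Qed.

Lemma slip_cst (c : R) : slip (fun=> c).
Proof. by exists 0 => // x y; rewrite subrr normr0 mul0r. Qed.

Lemma slip_comp f g : slip f -> elip g -> slip (f \o g).
Proof.
move=> [L L0 hL] [K K0 hK]; exists (L * K); first by rewrite mulr_ge0.
by move=> x y; rewrite (le_trans (hL _ _))// -mulrA ler_wpM2l.
Qed.

Lemma slip_max f g : slip f -> slip g -> slip (fun x => Num.max (f x) (g x)).
Proof.
move=> [L L0 hL] [K K0 hK]; exists (L + K); first by rewrite addr_ge0.
move=> x y; have := hL x y; have := hK x y.
have := mulr_ge0 L0 (enorm_ge0 (x - y)); have := mulr_ge0 K0 (enorm_ge0 (x - y)).
rewrite mulrDl !ler_norml => ? ?.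
by case: (leP (f x)) => ?; case: (leP (f y)) => ?; lra.
Qed.

Lemma slip_linear (a : R) f : slip f -> slip (fun x => a * f x).
Proof.
move=> [L L0 hL]; exists (`|a| * L); first by rewrite mulr_ge0.
by move=> x y; rewrite -mulrBr normrM -mulrA ler_wpM2l.
Qed.

Lemma slipD f g : slip f -> slip g -> slip (f \+ g).
Proof.
move=> [L L0 hL] [K K0 hK]; exists (L + K); first by rewrite addr_ge0.
move=> x y; rewrite /= opprD addrACA (le_trans (ler_normD _ _))// mulrDl.
by rewrite lerD.
Qed.

Lemma slip_abs f : slip f -> slip (fun x => `|f x|).
Proof.
move=> [L L0 hL]; exists L => // x y.
by rewrite (le_trans (ler_dist_dist _ _)).
Qed.

Lemma slip_min f g : slip f -> slip g -> slip (fun x => Num.min (f x) (g x)).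
Proof.
move=> [L L0 hL] [K K0 hK]; exists (L + K); first by rewrite addr_ge0.
move=> x y; have := hL x y; have := hK x y.
have := mulr_ge0 L0 (enorm_ge0 (x - y)); have := mulr_ge0 K0 (enorm_ge0 (x - y)).
rewrite mulrDl !ler_norml => ? ?.
by case: (leP (f x)) => ?; case: (leP (f y)) => ?; lra.
Qed.

(* Radial truncation; subtracting two of them gives globally Lipschitz
   radial projections that are the identity far away. *)
Definition rcap (p : pt R -> R) (c : R) x : pt R := (Num.max (p x) c)^-1 *: x.

Lemma enorm_rcap p (K c : R) x : 0 < c -> 0 <= K -> enorm x <= K * p x ->
  enorm (rcap p c x) <= K.
Proof.
move=> c0 K0 h; set M := Num.max (p x) c.
have M0 : 0 < M by rewrite lt_max c0 orbT.
rewrite /rcap enormZ -/M ger0_norm ?invr_ge0 ?(ltW M0)// ler_pdivrMl// mulrC.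
by rewrite (le_trans h)// ler_wpM2l// le_max lexx.
Qed.

Lemma elip_rcap p (K c : R) : slip p -> 0 < c -> 0 <= K ->
  (forall x, enorm x <= K * p x) -> elip (rcap p c).
Proof.
move=> sp c0 K0 hK; have [L L0 hL] := slip_max sp (slip_cst c).
exists (c^-1 * (1 + K * L)) => [|x y].
  by rewrite mulr_ge0 ?invr_ge0 ?(ltW c0)// addr_ge0// mulr_ge0.
have {hL} := hL x y; have := enorm_rcap c0 K0 (hK y); rewrite /rcap.
set M := Num.max (p x) c; set M' := Num.max (p y) c => bnd hL.
have cM : c <= M by rewrite le_max lexx orbT.
have cM' : c <= M' by rewrite le_max lexx orbT.
have M0 : 0 < M by apply: lt_le_trans cM.
have M'0 : 0 < M' by apply: lt_le_trans cM'.
(* The point and the truncated radius are changed one at a time; the last vector is [rcap p c y], of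
   norm at most [K] by [bnd]. *)
have -> : M^-1 *: x - M'^-1 *: y = M^-1 *: (x - y) + (M^-1 * (M' - M)) *: (M'^-1 *: y).
  rewrite scalerBr scalerA -mulrA mulrBl mulfV ?gt_eqF// mulrBr mulr1 mulrA.
  by rewrite mulVf ?gt_eqF// mul1r scalerBl addrA subrK.
rewrite (le_trans (enormD _ _))// [enorm (M^-1 *: _)]enormZ enormZ normrM.
rewrite (ger0_norm (_ : 0 <= M^-1)) ?invr_ge0 ?(ltW M0)// -!mulrA -mulrDr.
rewrite ler_pM ?invr_ge0 ?(ltW M0) ?addr_ge0 ?mulr_ge0 ?enorm_ge0//.
  by rewrite lef_pV2// posrE.
rewrite mulrDl mul1r lerD2l -mulrA mulrC ler_pM ?enorm_ge0//.
by rewrite distrC.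
Qed.

End Euclidean.

(** * The outer measure H2 *)

Section Hausdorff.
Context {R : realType}.
Implicit Types (A B F : set (pt R)) (d r : R).

Lemma ediam_le A r : 0 <= r ->
  ((ediam A <= r%:E)%E <-> forall x y, A x -> A y -> enorm (x - y) <= r).
Proof.
move=> r0; split=> [h x y Ax Ay|h].
  rewrite -lee_fin (le_trans _ h)//; apply: ereal_sup_ubound; right.
  by exists (x, y).
by apply: ge_ereal_sup => _ [->|[[x y] [/= Ax Ay] <-]]; rewrite lee_fin//; exact: h.
Qed.

Lemma ediam_ge0 A : (0 <= ediam A)%E.
Proof. by apply: ereal_sup_ubound; left. Qed.

Lemma ediam_set0 : ediam (@set0 (pt R)) = 0%E.
Proof. by apply/eqP; rewrite eq_le ediam_ge0 andbT; apply/ediam_le. Qed.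

Definition gauge2 A : \bar R := ((pi / 4)%:E * ediam A ^+ 2)%E.

Lemma pi4_ge0 : 0 <= pi / 4 :> R.
Proof. by rewrite divr_ge0// pi_ge0. Qed.

Lemma gauge2_ge0 A : (0 <= gauge2 A)%E.
Proof. by rewrite mule_ge0 ?lee_fin ?pi4_ge0// expe_ge0 ?ediam_ge0. Qed.

Lemma gauge2_set0 : gauge2 set0 = 0%E.
Proof. by rewrite /gauge2 ediam_set0 expe2 !mule0. Qed.

Lemma gauge2_le A r : 0 <= r -> (ediam A <= r%:E)%E ->
  (gauge2 A <= (pi / 4 * r ^+ 2)%:E)%E.
Proof.
move=> r0 h; rewrite /gauge2 [in leRHS]EFinM lee_pmul ?lee_fin ?pi4_ge0//.
  by rewrite expe_ge0 ?ediam_ge0.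
by rewrite expr2 EFinM expe2 lee_pmul ?ediam_ge0.
Qed.

(* All sets are measurable for the discrete structure, which turns
   [hausdorff2_delta] into an instance of [mu_ext]. *)
Definition discr := g_sigma_algebraType [set: set (pt R)].

(** The value +oo on sets of large diameter moves the constraint on the cover into the weight, since
    [mu_ext] takes the infimum over all covers. *)
Definition gauge2_delta d (A : set discr) : \bar R :=
  if (ediam (A : set (pt R)) <= d%:E)%E then gauge2 A else +oo%E.

Lemma gauge2_delta_set0 d : 0 <= d -> gauge2_delta d set0 = 0%E.
Proof. by move=> d0; rewrite /gauge2_delta ediam_set0 lee_fin d0 gauge2_set0. Qed.

Lemma gauge2_delta_ge0 d A : (0 <= gauge2_delta d A)%E.
Proof. by rewrite /gauge2_delta; case: ifP => // _; exact: gauge2_ge0. Qed.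

Lemma hausdorff2_deltaE d A : hausdorff2_delta d A = mu_ext (gauge2_delta d) A.
Proof.
apply/eqP; rewrite eq_le; apply/andP; split.
  apply: le_ereal_inf_tmp => _ [U [_ AU] <-].
  have [Ud|/existsNP[k Uk]] := pselect (forall k, (ediam (U k : set (pt R)) <= d%:E)%E).
    apply: ereal_inf_lbound; exists U => //; apply: eq_eseriesr => k _.
    by rewrite /gauge2_delta Ud.
  rewrite (@eseries_pinfty _ _ _ k) ?leey//.
    by move=> n _; rewrite -ltNye (lt_le_trans _ (gauge2_delta_ge0 _ _)).
  by rewrite /gauge2_delta; case: ifP.
apply: le_ereal_inf_tmp => _ [U [AU Ud] <-].
apply: ereal_inf_lbound; exists (U : (set discr)^nat).
  by split => // i; exact: sub_sigma_algebra.
by apply: eq_eseriesr => k _; rewrite /gauge2_delta Ud.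
Qed.

Lemma hausdorff2_delta_ge0 d A : (0 <= hausdorff2_delta d A)%E.
Proof. by rewrite hausdorff2_deltaE; apply: mu_ext_ge0 => X; exact: gauge2_delta_ge0. Qed.

Lemma hausdorff2_delta_set0 d : 0 <= d -> hausdorff2_delta d set0 = 0%E.
Proof.
move=> d0; rewrite hausdorff2_deltaE; apply: mu_ext0.
  exact: gauge2_delta_set0.
by move=> X; exact: gauge2_delta_ge0.
Qed.

Lemma le_hausdorff2_delta d A B : A `<=` B ->
  (hausdorff2_delta d A <= hausdorff2_delta d B)%E.
Proof. by move=> AB; rewrite !hausdorff2_deltaE; exact: le_mu_ext. Qed.

Lemma hausdorff2_delta_sigma_subadditive d : sigma_subadditive (@hausdorff2_delta R d).
Proof.
move=> F; rewrite hausdorff2_deltaE.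
rewrite (le_trans (mu_ext_sigma_subadditive _ _))//.
  by move=> X; exact: gauge2_delta_ge0.
by rewrite le_eqVlt; apply/orP; left; apply/eqP/eq_eseriesr => k _; rewrite hausdorff2_deltaE.
Qed.

Lemma hausdorff2_delta_anti d r A : d <= r ->
  (hausdorff2_delta r A <= hausdorff2_delta d A)%E.
Proof.
move=> dr; apply/ereal_inf_le_tmp => _ [U [AU Ud] <-]; exists U => //; split => //.
by move=> k; rewrite (le_trans (Ud k))// lee_fin.
Qed.

Lemma hausdorff2_delta_le_H2 d A : 0 < d -> (hausdorff2_delta d A <= H2 A)%E.
Proof. by move=> d0; apply: ereal_sup_ubound; exists d. Qed.

Lemma H2_le A (x : \bar R) : (forall d, 0 < d -> (hausdorff2_delta d A <= x)%E) ->
  (H2 A <= x)%E.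
Proof. by move=> h; apply: ge_ereal_sup => _ [d d0 <-]; exact: h. Qed.

Lemma H2_ge0 A : (0 <= H2 A)%E.
Proof. exact: le_trans (hausdorff2_delta_ge0 1 A) (hausdorff2_delta_le_H2 _ _). Qed.

Lemma H2_set0 : H2 (@set0 (pt R)) = 0%E.
Proof.
apply/eqP; rewrite eq_le H2_ge0 andbT; apply: H2_le => d d0.
by rewrite hausdorff2_delta_set0// ltW.
Qed.

Lemma le_H2 A B : A `<=` B -> (H2 A <= H2 B)%E.
Proof.
move=> AB; apply: H2_le => d d0; apply: le_trans (hausdorff2_delta_le_H2 _ d0).
exact: le_hausdorff2_delta.
Qed.

Lemma H2_sigma_subadditive : sigma_subadditive (@H2 R).
Proof.
move=> F; apply: H2_le => d d0.
rewrite (le_trans (hausdorff2_delta_sigma_subadditive _ _))//.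
apply: lee_nneseries => [k _ _|k _]; first exact: hausdorff2_delta_ge0.
exact: hausdorff2_delta_le_H2.
Qed.

HB.instance Definition _ := isOuterMeasure.Build R (pt R) (@H2 R)
  H2_set0 H2_ge0 le_H2 H2_sigma_subadditive.

Definition H2o : {outer_measure set (pt R) -> \bar R} := @H2 R.

Lemma H2U A B : (H2 (A `|` B) <= H2 A + H2 B)%E.
Proof. exact: (outer_measureU2 H2o). Qed.

Lemma H2_null_subset A B : A `<=` B -> H2 B = 0%E -> H2 A = 0%E.
Proof. by move=> AB B0; apply/eqP; rewrite eq_le H2_ge0 andbT -B0 le_H2. Qed.

Lemma H2_nullU A B : H2 A = 0%E -> H2 B = 0%E -> H2 (A `|` B) = 0%E.
Proof.
move=> A0 B0; apply/eqP; rewrite eq_le H2_ge0 andbT (le_trans (H2U _ _))//.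
by rewrite A0 B0 adde0.
Qed.

(* Distant sets cannot both be met by the same small piece of a cover. *)
Lemma H2_separated A B r : 0 < r ->
  (forall x y, A x -> B y -> r <= enorm (x - y)) ->
  (H2 A + H2 B <= H2 (A `|` B))%E.
Proof.
move=> r0 AB.
suff h (d e : R) : 0 < d -> 0 < e ->
    (hausdorff2_delta d A + hausdorff2_delta e B <= H2 (A `|` B))%E.
  have [->|AB_fin] := eqVneq (H2 (A `|` B)) +oo%E; first by rewrite leey.
  have fin X : X `<=` A `|` B -> H2 X \is a fin_num.
    move=> XAB; rewrite ge0_fin_numE ?H2_ge0// (le_lt_trans (le_H2 XAB))//.
    by rewrite ltey.
  have finA : H2 A \is a fin_num by apply: fin; exact: subsetUl.
  have finB : H2 B \is a fin_num by apply: fin; exact: subsetUr.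
  rewrite -leeBrDr//; apply: H2_le => d d0; rewrite leeBrDr// addeC.
  have find : hausdorff2_delta d A \is a fin_num.
    rewrite ge0_fin_numE ?hausdorff2_delta_ge0//.
    by rewrite (le_lt_trans (hausdorff2_delta_le_H2 _ d0))// -ge0_fin_numE ?H2_ge0.
  by rewrite -leeBrDr//; apply: H2_le => e e0; rewrite leeBrDr// addeC h.
move=> d0 e0; pose m := Num.min (Num.min d e) (r / 2).
have m0 : 0 < m by rewrite !lt_min d0 e0 divr_gt0.
apply: le_trans (hausdorff2_delta_le_H2 _ m0).
apply: (@le_trans _ _ (hausdorff2_delta m A + hausdorff2_delta m B)%E).
  by rewrite leeD// hausdorff2_delta_anti// !ge_min lexx ?orbT.
apply: le_ereal_inf_tmp => _ [U [ABU Ud] <-].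
(* Pieces that miss [X] are replaced by the empty set. As [m <= r / 2 < r], no index keeps a piece
   for both [A] and [B], so the two subcovers together cost at most as much as [U]. *)
pose V X k := if `[< U k `&` X !=set0 >] then U k else set0.
have mV X k : (ediam (V X k) <= m%:E)%E.
  rewrite /V; case: ifP => // _; rewrite ediam_set0 lee_fin ltW//.
have cV X : X `<=` A `|` B -> X `<=` \bigcup_k V X k.
  move=> XAB x Xx; have [k _ Ukx] := ABU _ (XAB _ Xx); exists k => //.
  by rewrite /V ifT//; apply/asboolP; exists x.
have hV X : X `<=` A `|` B ->
    (hausdorff2_delta m X <= \sum_(0 <= k <oo) gauge2 (V X k))%E.
  by move=> XAB; apply: ereal_inf_lbound; exists (V X) => //; split => //; exact: cV.
apply: le_trans (leeD (hV A _) (hV B _)) _; [by left|by right|].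
rewrite -nneseriesD; try by move=> *; exact: gauge2_ge0.
apply: lee_nneseries => [k _ _|k _]; first by rewrite adde_ge0// gauge2_ge0.
rewrite /V; case: asboolP => [[x [Ux Ax]]|_]; last first.
  by rewrite gauge2_set0 add0e; case: ifP => // _; rewrite gauge2_set0 gauge2_ge0.
case: asboolP => [[y [Uy By]]|_]; last by rewrite gauge2_set0 adde0.
have := AB _ _ Ax By; have /ediam_le/(_ _ _ Ux Uy) := Ud k => /(_ (ltW m0)) h1 h2.
have mr : m <= r / 2 by rewrite !ge_min lexx orbT.
by exfalso; have := le_trans h2 (le_trans h1 mr); lra.
Qed.

End Hausdorff.

(** * Caratheodory property of closed sets and elementary area bounds *)

Section HausdorffMeasure.
Context {R : realType}.
Implicit Types (A B F X : set (pt R)) (d r : R).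

(* The rings at distance between 1/(k+2) and 1/(k+1) from F: two
   non-consecutive ones are at a positive distance from each other, so their
   measures are summable. *)
Lemma closed_caratheodory F : closed F -> (@H2o R).-caratheodory F.
Proof.
move=> cF; apply: le_caratheodory_measurable => X; rewrite /H2o/=.
have [->|/eqP Xoo] := eqVneq (H2 X) +oo%E; first by rewrite leey.
have Xfin : (H2 X < +oo)%E by rewrite ltey; apply/eqP.
pose A n := X `&` [set x | forall w, F w -> n.+1%:R^-1 <= enorm (x - w)].
pose S n := A n.+1 `\` A n.
have inv_le m n : (m <= n)%N -> (n.+1%:R^-1 : R) <= m.+1%:R^-1.
  by move=> mn; rewrite lef_pV2 ?posrE ?ltr0n// ler_nat ltnS.
have A_mono m n : (m <= n)%N -> A m `<=` A n.
  move=> mn x [Xx h]; split => // w /h; exact/le_trans/inv_le.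
have AX n : A n `<=` X by move=> x [].
have step n : (H2 (A n) + H2 (S n.+1) <= H2 (A n.+2))%E.
  apply: (@le_trans _ _ (H2 (A n `|` S n.+1))); last first.
    apply: le_H2 => x [|[]//]; apply: A_mono; exact: leqW (leqnSn _).
  apply: (@H2_separated _ _ _ (n.+1%:R^-1 - n.+2%:R^-1)).
    by rewrite subr_gt0 ltf_pV2 ?posrE ?ltr0n// ltr_nat.
  move=> x y [_ hx] [[Xy _] nAy].
  have [w Fw yw] : exists2 w, F w & enorm (y - w) < n.+2%:R^-1.
    apply: contrapT => h; apply: nAy; split => // w Fw; rewrite leNgt.
    by apply/negP => yw; apply: h; exists w.
  rewrite lerBlDr (le_trans (hx w Fw))// (le_trans (enormBD y x w))//.
  by rewrite lerD2l ltW.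
(* Two consecutive sets appear on the right because, by [step], adding the ring [S n.+1] turns [A n]
   into [A n.+2]. *)
have sumS n : (\sum_(0 <= k < n.+1) H2 (S k) <= H2 (A n) + H2 (A n.+1))%E.
  elim: n => [|n IH].
    rewrite big_nat1; apply: (le_trans (le_H2 (@subDsetl _ _ _))).
    by rewrite leeDr// H2_ge0.
  rewrite big_nat_recr//=; apply: le_trans (leeD2r _ IH) _.
  by rewrite addeAC addeC; apply: leeD2l; exact: step.
have sumS_fin : (\sum_(0 <= k <oo) H2 (S k) < +oo)%E.
  apply: (@le_lt_trans _ _ (H2 X + H2 X)%E); last by rewrite lte_add_pinfty.
  apply: lime_le; first by apply: is_cvg_nneseries => *; exact: H2_ge0.
  apply: nearW => -[|n]; first by rewrite big_geq// adde_ge0 ?H2_ge0.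
  by rewrite (le_trans (sumS n))// leeD// le_H2.
(* Points off [F] that are not in [A n] lie in the rings of index at least [n]; their total measure
   is the tail of a convergent series and vanishes in the limit. *)
have key n : (H2 (X `&` F) + H2 (X `&` ~` F) <= H2 X + \sum_(n <= k <oo) H2 (S k))%E.
  have XF : X `&` ~` F `<=` A n `|` \bigcup_(k in ~` `I_n) S k.
    move=> x [Xx nFx]; have [r r0 hr] := closed_far cF nFx.
    have [N Nr] : exists N, A N x.
      exists (Num.truncn r^-1); split => // w /hr; rewrite enormB; apply: le_trans.
      by rewrite invf_ple ?posrE ?ltr0n// ltW// truncnS_gt.
    have [|/negP nA] := boolP `[< A n x >]; first by move/asboolP; left.
    right; pose P m := `[< A m x >].
    have exP : exists m, P m by exists N; exact/asboolP.
    have [m /asboolP Am mmin] := ex_minnP exP.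
    have nm : (n < m)%N.
      rewrite ltnNge; apply/negP => mn; apply: nA; apply/asboolP.
      exact: A_mono Am.
    case: m nm Am mmin => [//|m] nm Am mmin; exists m.
      by rewrite /= -ltnS; apply/negP; rewrite -leqNgt.
    by split => // /asboolP/mmin; rewrite ltnn.
  apply: (@le_trans _ _ (H2 (X `&` F) + (H2 (A n) + \sum_(n <= k <oo) H2 (S k)))%E).
    apply: leeD2l; apply: le_trans (le_H2 XF) _; apply: le_trans (H2U _ _) _.
    by apply: leeD2l; exact: (outer_measure_sigma_subadditive_tail H2o).
  rewrite addeA; apply: leeD2r.
  apply: (@le_trans _ _ (H2 (X `&` F `|` A n))).
    apply: (@H2_separated _ _ _ n.+1%:R^-1); first by rewrite invr_gt0.
    by move=> x y [_ Fx] [_ hy]; rewrite enormB; exact: hy.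
  by apply: le_H2 => x [[]|/AX].
have tail := nneseries_tail_cvg sumS_fin (fun k _ => H2_ge0 (S k)).
have lim_r : (H2 X + \sum_(n <= k <oo) H2 (S k))%E @[n --> \oo] --> (H2 X + 0)%E.
  apply: cvgeD => //; last exact: cvg_cst.
  by rewrite fin_num_adde_defl// ge0_fin_numE// H2_ge0.
rewrite adde0 in lim_r.
apply: cvge_to_ge lim_r _; exact: nearW.
Qed.

Lemma H2_contraction A (f : pt R -> pt R) :
  (forall x y, A x -> A y -> enorm (f x - f y) <= enorm (x - y)) ->
  (H2 (f @` A) <= H2 A)%E.
Proof.
move=> hf; apply: H2_le => d d0; apply: le_trans (hausdorff2_delta_le_H2 _ d0).
apply: le_ereal_inf_tmp => _ [U [AU Ud] <-].
pose V k := f @` (U k `&` A).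
have VU k : (ediam (V k) <= ediam (U k))%E.
  apply: ge_ereal_sup => _ [->|[[_ _] [/= [x [Ux Ax] <-] [y [Uy Ay] <-]] <-]].
    exact: ediam_ge0.
  apply: (@le_trans _ _ (enorm (x - y))%:E); first by rewrite lee_fin hf.
  by apply: ereal_sup_ubound; right; exists (x, y).
apply: (@le_trans _ _ (\sum_(0 <= k <oo) gauge2 (V k))%E).
  apply: ereal_inf_lbound; exists V => //; split => [_ [x Ax <-]|k].
    by have [k _ Ux] := AU _ Ax; exists k => //; exists x.
  exact: le_trans (VU k) (Ud k).
apply: lee_nneseries => [k _ _|k _]; first exact: gauge2_ge0.
rewrite /gauge2 lee_pmul ?lee_fin ?pi4_ge0 ?expe_ge0 ?ediam_ge0//.
by rewrite !expe2 lee_pmul ?ediam_ge0.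
Qed.

Lemma hausdorff2_delta_cells A n (U : nat -> set (pt R)) d r :
  0 <= r -> r <= d ->
  (forall x, A x -> exists2 k, (k < n)%N & U k x) ->
  (forall k x y, U k x -> U k y -> enorm (x - y) <= r) ->
  (hausdorff2_delta d A <= (n%:R * (pi / 4 * r ^+ 2))%:E)%E.
Proof.
move=> r0 rd AU Ur; pose V k := if (k < n)%N then U k else set0.
have Vr k : (ediam (V k) <= r%:E)%E.
  rewrite /V; case: ifP => _; last by rewrite ediam_set0.
  by apply/ediam_le => //; exact: Ur.
apply: (@le_trans _ _ (\sum_(0 <= k <oo) gauge2 (V k))%E).
  apply: ereal_inf_lbound; exists V => //; split => [x /AU[k kn Ux]|k].
    by exists k => //; rewrite /V kn.
  by rewrite (le_trans (Vr k)).
rewrite (nneseries_split _ n); last by move=> *; exact: gauge2_ge0.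
rewrite add0n [X in (_ + X)%E]eseries0 ?adde0; last first.
  by move=> k nk _; rewrite /V ltnNge nk gauge2_set0.
rewrite big_mkord; apply: (@le_trans _ _ (\sum_(i < n) (pi / 4 * r ^+ 2)%:E)%E).
  by apply: lee_sum => i _; exact: gauge2_le.
by rewrite sumEFin sumr_const card_ord mulr_natl.
Qed.

Lemma unit_cell (N : nat) (s : R) : (0 < N)%N -> 0 <= s <= 1 ->
  exists2 k, (k < N)%N & k%:R / N%:R <= s <= k.+1%:R / N%:R.
Proof.
move=> N0 /andP[s0 s1]; have N0' : 0 < N%:R :> R by rewrite ltr0n.
have [s1'|s1'] := ltP s 1; last first.
  (* The value 1 belongs to the last closed cell, of index [N - 1]. *)
  exists N.-1; rewrite prednK// divff ?gt_eqF// s1 andbT (le_trans _ s1')//.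
  by rewrite ler_pdivrMr// mul1r ler_nat leq_pred.
have sN : 0 <= s * N%:R by rewrite mulr_ge0// ltW.
have /andP[h1 h2] := truncn_itv sN.
exists (Num.truncn (s * N%:R)).
  by rewrite -(ltr_nat R) (le_lt_trans h1)// gtr_pMl.
by rewrite ler_pdivrMr// h1 ler_pdivlMr// ltW.
Qed.

Lemma cell_dist (N k : nat) (s t : R) : (0 < N)%N ->
  k%:R / N%:R <= s <= k.+1%:R / N%:R -> k%:R / N%:R <= t <= k.+1%:R / N%:R ->
  `|s - t| <= N%:R^-1.
Proof.
move=> N0; rewrite -addn1 natrD mulrDl div1r ler_norml.
by move=> /andP[? ?] /andP[? ?]; apply/andP; split; lra.
Qed.

Lemma exists_large (c d : R) : 0 < d -> exists2 N : nat, (0 < N)%N & c / N%:R <= d.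
Proof.
move=> d0; exists (Num.truncn `|c / d|).+1 => //.
rewrite ler_pdivrMr ?ltr0n// mulrC -ler_pdivrMr// (le_trans (ler_norm _))// ltW//.
exact: truncnS_gt.
Qed.

Definition parallelogram (p a b : pt R) : set (pt R) :=
  [set x | exists s t : R, [/\ 0 <= s <= 1, 0 <= t <= 1 & x = p + s *: a + t *: b]].

(** A grid of N^2 cells of diameter at most D / N costs pi / 4 D^2 whatever N is, so one bound
    serves every scale [d]. *)
Lemma H2_parallelogram (p a b : pt R) : (H2 (parallelogram p a b) < +oo)%E.
Proof.
pose D := enorm a + enorm b.
have D0 : 0 <= D by rewrite addr_ge0 ?enorm_ge0.
apply: (@le_lt_trans _ _ (pi / 4 * D ^+ 2)%:E); last by rewrite ltry.
apply: H2_le => d d0; have [N N0 DN] := exists_large D d0.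
have N0' : 0 < N%:R :> R by rewrite ltr0n.
(* The index [k] codes the cell of coordinates [k %% N] and [k %/ N]. *)
pose U k := [set x | exists s t : R,
  [/\ (k %% N)%:R / N%:R <= s <= (k %% N).+1%:R / N%:R,
      (k %/ N)%:R / N%:R <= t <= (k %/ N).+1%:R / N%:R &
      x = p + s *: a + t *: b]].
have := @hausdorff2_delta_cells (parallelogram p a b) (N * N) U d (D / N%:R).
have -> : (N * N)%:R * (pi / 4 * (D / N%:R) ^+ 2) = pi / 4 * D ^+ 2.
  by rewrite natrM; field; rewrite gt_eqF.
apply => //; first by rewrite divr_ge0.
  move=> x [s [t [/(unit_cell N0)[i iN hi] /(unit_cell N0)[j jN hj] ->]]].
  exists (j * N + i)%N.
    by rewrite (@leq_trans (j * N + N))// ?ltn_add2l// -mulSnr leq_pmul2r.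
  exists s, t; split => //; first by rewrite modnMDl modn_small.
  by rewrite divnMDl// divn_small// addn0.
move=> k _ _ [s [t [hs ht ->]]] [s' [t' [hs' ht' ->]]].
rewrite !opprD addrACA [X in enorm (X + _)]addrACA subrr add0r -!scalerBl.
rewrite (le_trans (enormD _ _))// !enormZ /D mulrDl lerD//.
  by rewrite mulrC ler_wpM2l ?enorm_ge0// (cell_dist N0 hs hs').
by rewrite mulrC ler_wpM2l ?enorm_ge0// (cell_dist N0 ht ht').
Qed.

(** N pieces of length L / N, where L is the norm of [a], cost pi / 4 L^2 / N. The factor [N1] of N
    brings the mesh below [d], the factor [N2] the cost below [e]. *)
Lemma H2_unit_segment (p a : pt R) :
  H2 [set x | exists2 s : R, 0 <= s <= 1 & x = p + s *: a] = 0%E.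
Proof.
set A := (X in H2 X); apply/eqP; rewrite eq_le H2_ge0 andbT.
apply: H2_le => d d0; apply/lee_addgt0Pr => e e0; rewrite add0e.
have D0 := enorm_ge0 a.
have [N1 N10 hN1] := exists_large (enorm a) d0.
have [N2 N20 hN2] := exists_large (pi / 4 * enorm a ^+ 2) e0.
pose N := (N1 * N2)%N; have N0 : (0 < N)%N by rewrite muln_gt0 N10.
have N0' : 0 < N%:R :> R by rewrite ltr0n.
pose U k := [set x | exists2 s : R, k%:R / N%:R <= s <= k.+1%:R / N%:R & x = p + s *: a].
apply: (@le_trans _ _ (N%:R * (pi / 4 * (enorm a / N%:R) ^+ 2))%:E).
  apply: (@hausdorff2_delta_cells _ N U); first by rewrite divr_ge0.
  - rewrite (le_trans _ hN1)// ler_wpM2l// lef_pV2 ?posrE ?ltr0n//.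
    by rewrite ler_nat leq_pmulr.
  - by move=> x [s /(unit_cell N0)[k kN hk] ->]; exists k => //; exists s.
  move=> k _ _ [s hs ->] [s' hs' ->].
  rewrite opprD addrACA subrr add0r -scalerBl enormZ mulrC ler_wpM2l//.
  exact: (cell_dist N0 hs hs').
rewrite lee_fin (le_trans _ hN2)//.
have -> : N%:R * (pi / 4 * (enorm a / N%:R) ^+ 2) = pi / 4 * enorm a ^+ 2 / N%:R.
  by field; rewrite gt_eqF.
apply: ler_wpM2l; first by rewrite mulr_ge0 ?pi4_ge0 ?sqr_ge0.
by rewrite lef_pV2 ?posrE ?ltr0n// ler_nat leq_pmull.
Qed.

Lemma H2_bounded_line (p a : pt R) (M : R) :
  H2 [set x | exists2 s : R, `|s| <= M & x = p + s *: a] = 0%E.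
Proof.
apply: H2_null_subset (H2_unit_segment (p - M *: a) ((2 * M) *: a)).
move=> _ [s sM ->]; have M0 : 0 <= M by apply: le_trans sM.
have [M00|M00] := eqVneq M 0.
  exists 0; first by rewrite lexx ler01.
  by move: sM; rewrite M00 normr_le0 => /eqP ->; rewrite !scale0r subr0 addr0.
have M0' : 0 < M by rewrite lt_neqAle eq_sym M00.
exists ((s + M) / (2 * M)).
  move: sM; rewrite ler_norml => /andP[? ?].
  by rewrite divr_ge0 ?mulr_ge0//=; [rewrite ler_pdivrMr ?mulr_gt0//; lra|lra].
rewrite scalerA divfK ?mulf_neq0 ?pnatr_eq0// scalerDl addrACA addNr.
by rewrite addr0.
Qed.

End HausdorffMeasure.

(** * The regular tetrahedron and its cone *)

Section FourIndices.

Lemma exists_notin (s : seq 'I_4) : (size s < 4)%N -> exists k, k \notin s.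
Proof.
move=> s4; apply/existsP; apply: contraLR s4; rewrite negb_exists -leqNgt.
move=> /forallP h; rewrite -{1}(size_enum_ord 4).
by apply: uniq_leq_size (enum_uniq _) _ => i _; have := h i; rewrite negbK.
Qed.

Lemma other_two (i j : 'I_4) : i != j -> exists k l, uniq [:: i; j; k; l].
Proof.
move=> ij; have [k] := @exists_notin [:: i; j] isT.
have [l] := @exists_notin [:: i; j; k] isT.
rewrite !inE !negb_or => /and3P[li lj lk] /andP[ki kj]; exists k, l.
by rewrite /= !inE !negb_or ij !(eq_sym i) ki li !(eq_sym j) kj lj eq_sym lk.
Qed.

Lemma mem_four (i j k l : 'I_4) : uniq [:: i; j; k; l] -> forall m, m \in [:: i; j; k; l].
Proof.
move=> u m; have [//|nm] := boolP (m \in [:: i; j; k; l]).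
have : (size [:: m; i; j; k; l] <= size (enum 'I_4))%N.
  apply: uniq_leq_size => [|x _]; last by rewrite mem_enum.
  by rewrite cons_uniq nm.
by rewrite size_enum_ord.
Qed.

Lemma sum_four (V : nmodType) (F : 'I_4 -> V) (i j k l : 'I_4) :
  uniq [:: i; j; k; l] -> \sum_m F m = F i + F j + F k + F l.
Proof.
move=> u; rewrite (perm_big [:: i; j; k; l])/=.
  by rewrite !big_cons big_nil addr0 !addrA.
apply: uniq_perm => //; first exact: index_enum_uniq.
by move=> m; rewrite mem_index_enum (mem_four u).
Qed.

End FourIndices.

Section MaxOfLinearForms.
Context {R : realType} {n : nat}.
Implicit Types (a : 'I_n.+1 -> pt R) (x y z : pt R).

(** The default value of the big operator is one of the forms, so that the result is the true
    maximum, possibly negative. *)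
Definition maxdot a z : R := \big[Num.max/dot (a ord0) z]_i dot (a i) z.

Lemma maxdot_ge a i z : dot (a i) z <= maxdot a z.
Proof. exact: le_bigmax. Qed.

Lemma maxdot_eq a z : exists i, maxdot a z = dot (a i) z.
Proof.
rewrite /maxdot; elim/big_ind: _ => [|x y [i ->] [j ->]|i _]; [by exists ord0| |by exists i].
by case: leP => _; [exists j|exists i].
Qed.

Lemma maxdot_leP a z (c : R) : (forall i, dot (a i) z <= c) <-> maxdot a z <= c.
Proof.
split=> [h|h i]; last exact: le_trans (maxdot_ge _ _ _) h.
by have [i ->] := maxdot_eq a z.
Qed.

Lemma maxdotZ a (c : R) z : 0 <= c -> maxdot a (c *: z) = c * maxdot a z.
Proof.
move=> c0; apply/eqP; rewrite eq_le; apply/andP; split.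
  by apply/maxdot_leP => i; rewrite dotZr ler_wpM2l// maxdot_ge.
by have [i ->] := maxdot_eq a z; rewrite -dotZr maxdot_ge.
Qed.

Lemma slip_maxdot a : slip (maxdot a).
Proof.
rewrite /maxdot; elim: index_enum => [|i r IH].
  have [L L0 h] := slip_dot (a ord0).
  by exists L => // x y; rewrite !big_nil.
have [L L0 h] := slip_max (slip_dot (a i)) IH.
by exists L => // x y; rewrite !big_cons.
Qed.

Lemma continuous_maxdot a : continuous (maxdot a).
Proof. exact/slip_continuous/slip_maxdot. Qed.

Lemma closed_le_continuous (p : pt R -> R) (c : R) : continuous p ->
  closed [set z | p z <= c].
Proof.
move=> cp; rewrite (_ : [set z | _] = p @^-1` [set t | t <= c])//.
by apply: closed_comp => [x _|]; [exact: cp|exact: closed_le].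
Qed.

Lemma open_lt_continuous (p : pt R -> R) (c : R) : continuous p ->
  open [set z | p z < c].
Proof.
move=> cp; rewrite (_ : [set z | _] = p @^-1` [set t | t < c])//.
by apply: open_comp => [x _|]; [exact: cp|exact: open_lt].
Qed.

(** By homogeneity (1 + e) z leaves the sublevel set as soon as z is on the level 1, so such a z is
    not interior. *)
Lemma bdry_sublevel a : bdry [set z | maxdot a z <= 1] = [set z | maxdot a z = 1].
Proof.
have cC := closed_le_continuous (c := 1) (@continuous_maxdot a).
rewrite /bdry -(closure_id _).1//; apply/seteqP; split => z /=.
  move=> [z1 nz]; apply/eqP; rewrite eq_le z1/= leNgt; apply/negP => z1'; apply: nz.
  have := open_lt_continuous (c := 1) (@continuous_maxdot a).
  rewrite openE => /(_ z z1'); apply: filterS => x; exact: ltW.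
move=> z1; rewrite z1; split => //; rewrite /interior/= => /nbhs_enormP[r r0 zr].
pose e := r / (enorm z + 1) / 2.
have z0 : 0 < enorm z + 1 by rewrite ltr_wpDl// enorm_ge0.
have e0 : 0 < e by rewrite !divr_gt0.
have : maxdot a ((1 + e) *: z) <= 1.
  apply: zr; rewrite scalerDl scale1r addrC addKr enormZ gtr0_norm//.
  have : e * (enorm z + 1) = r / 2 by rewrite /e; field; rewrite gt_eqF.
  by rewrite mulrDr mulr1; lra.
by rewrite maxdotZ ?z1 ?mulr1; lra.
Qed.

End MaxOfLinearForms.

Section Tetrahedron.
Context {R : realType}.
Implicit Types (x y z : pt R) (u : 'I_4 -> pt R).

(** Directions of the vertices of a regular tetrahedron seen from its centre: -1/3 is the cosine of
    the angle between two of them. *)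
Definition tetra u := (forall i, dot (u i) (u i) = 1) /\
  (forall i j, i != j -> dot (u i) (u j) = - 3^-1).

Section Fixed.
Variables (u : 'I_4 -> pt R) (tu : tetra u).

Lemma tetra_dot i j : dot (u i) (u j) = if i == j then 1 else - 3^-1.
Proof. by case: eqVneq => [->|/tu.2//]; exact: tu.1. Qed.

Lemma tetra_norm i : enorm (u i) = 1.
Proof. by rewrite /enorm tu.1 sqrtr1. Qed.

Lemma tetra_sum0 : \sum_i u i = 0.
Proof.
apply: dot_eq0; rewrite dot_suml big1// => i _; rewrite dot_sumr.
rewrite (bigD1 i)//= tu.1 (eq_bigr (fun=> - 3^-1)); last first.
  by move=> j ji; rewrite tu.2// eq_sym.
by rewrite sumr_const cardC1 card_ord /= -mulr_natl; lra.
Qed.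

Lemma dot_sum0 z : \sum_i dot (u i) z = 0.
Proof. by rewrite -dot_suml tetra_sum0 dot0l. Qed.

Lemma tetra_span z : (forall k, dot (u k) z = 0) -> z = 0.
Proof.
move=> uz; pose w (i : 'I_3) := u (lift ord_max i).
pose M : 'M[R]_3 := \matrix_i w i.
(* [G] is the inverse of the Gram matrix of three of the vectors; this makes [M] invertible. *)
pose G : 'M[R]_3 := \matrix_(i, j) (3 / 4 * ((i == j)%:R + 1)).
have MG : M *m (M^T *m G) = 1%:M.
  have MM : M *m M^T = \matrix_(i, j) (if i == j then 1 else - 3^-1).
    apply/matrixP => i j; rewrite !mxE.
    transitivity (dot (w i) (w j)).
      by apply: eq_bigr => k _; rewrite !mxE.
    by rewrite tetra_dot (inj_eq lift_inj).
  rewrite mulmxA MM; apply/matrixP => i j; rewrite !mxE.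
  rewrite !big_ord_recl big_ord0 !mxE.
  by case: i => -[|[|[|//]]] hi; case: j => -[|[|[|//]]] hj /=;
     rewrite -?val_eqE/= ?mulr1n ?mulr0n; lra.
have [Mu _] := mulmx1_unit MG.
have Mz : M *m z^T = 0.
  apply/matrixP => i j; rewrite !mxE -[RHS](uz (lift ord_max i)).
  by apply: eq_bigr => k _; rewrite !mxE (ord1 j).
by apply: trmx_inj; rewrite trmx0 -(mulKmx Mu z^T) Mz mulmx0.
Qed.

(** The four vectors form a tight frame: the projections on their directions sum to 4/3 of the
    identity. *)
Lemma tetra_repr z : z = (3 / 4) *: \sum_i dot (u i) z *: u i.
Proof.
apply/eqP; rewrite -subr_eq0; apply/eqP; apply: tetra_span => k.
rewrite dotBr dotZr dot_sumr (bigD1 k)//= dotZr tu.1.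
rewrite (eq_bigr (fun i => - 3^-1 * dot (u i) z)); last first.
  by move=> i ik; rewrite dotZr tu.2 1?eq_sym// mulrC.
rewrite -mulr_sumr; have := dot_sum0 z; rewrite (bigD1 k)//=.
by move=> /eqP; rewrite addrC addr_eq0 => /eqP ->; lra.
Qed.

Lemma tetra_repr4 i j k l z : uniq [:: i; j; k; l] ->
  z = (3 / 4) *: (dot (u i) z *: u i + dot (u j) z *: u j
                  + dot (u k) z *: u k + dot (u l) z *: u l).
Proof. by move=> h; rewrite {1}(tetra_repr z) (sum_four _ h). Qed.

Lemma tetra_sum4 i j k l : uniq [:: i; j; k; l] -> u l = - (u i + u j + u k).
Proof.
move=> h; have := tetra_sum0; rewrite (sum_four _ h) => /eqP.
by rewrite addrC addr_eq0 => /eqP.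
Qed.

Lemma dot_sum4 i j k l z : uniq [:: i; j; k; l] ->
  dot (u i) z + dot (u j) z + dot (u k) z + dot (u l) z = 0.
Proof. by move=> h; rewrite -(dot_sum0 z) (sum_four _ h). Qed.

(** Minkowski gauge of the solid tetrahedron with vertices [u k]: the face opposite to [u k] lies in
    the plane where [dot (u k)] is -1/3. *)
Definition gaugeT z := maxdot (fun k => - 3 *: u k) z.

Lemma gaugeT_leP z (c : R) : (forall k, - c <= 3 * dot (u k) z) <-> gaugeT z <= c.
Proof.
rewrite /gaugeT -maxdot_leP; split => h k; have := h k; rewrite dotZl; lra.
Qed.

Lemma gaugeT_ge z k : - gaugeT z <= 3 * dot (u k) z.
Proof. by have /gaugeT_leP := lexx (gaugeT z). Qed.

Lemma enorm_le_gaugeT z : enorm z <= gaugeT z.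
Proof.
have h := gaugeT_ge z.
have un : uniq [:: 0; 1; 2; 3 : 'I_4] by [].
have s0 := dot_sum4 z un.
have n0 : 0 <= gaugeT z.
  by have := h 0; have := h 1; have := h 2; have := h 3; lra.
rewrite -(@ler_pXn2r _ 2)// ?nnegrE ?enorm_ge0// enorm_sqr.
rewrite {1}(tetra_repr4 z un) dotZl !dotDl !dotZl.
move: (h 0) (h 1) (h 2) (h 3) s0 n0.
move: (gaugeT z) (dot (u 0) z) (dot (u 1) z) (dot (u 2) z) (dot (u 3) z).
move=> n a b c d ha hb hc hd s0 n0.
(* Up to a factor, the barycentric coordinates of [z] in the tetrahedron dilated by [n]. They are
   nonnegative, so the sum of their squares is at most the square of their sum. *)
pose A := a + n / 3; pose B := b + n / 3; pose C := c + n / 3; pose D := d + n / 3.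
have A0 : 0 <= A by rewrite /A; lra.
have B0 : 0 <= B by rewrite /B; lra.
have C0 : 0 <= C by rewrite /C; lra.
have D0 : 0 <= D by rewrite /D; lra.
have S : A + B + C + D = 4 / 3 * n by rewrite /A /B /C /D; lra.
have cross : 0 <= A * B + A * C + A * D + B * C + B * D + C * D.
  by rewrite !addr_ge0// mulr_ge0.
have e : a * a + b * b + c * c + d * d =
   (A + B + C + D) ^+ 2 - 2 * (A * B + A * C + A * D + B * C + B * D + C * D)
   - 2 / 3 * n * (A + B + C + D) + 4 / 9 * n ^+ 2.
  by rewrite /A /B /C /D; field.
by rewrite e S; nra.
Qed.

End Fixed.

(** The T cone as the common boundary of the four regions where a given form is the least one: on it
    the least value is attained at least twice. *)
Definition sectors u : set (pt R) := [set x | exists k l : 'I_4,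
  [/\ k != l, dot (u k) x = dot (u l) x & forall m, dot (u k) x <= dot (u m) x]].

(** Since the [u m] sum to 0, the least value can be subtracted from the four coefficients of
    [tetra_repr]; the terms of the two minimal indices then disappear. *)
Lemma sectorsP u x : tetra u -> sectors u x <->
  exists (i j : 'I_4) (s t : R), [/\ i != j, 0 <= s, 0 <= t & x = s *: u i + t *: u j].
Proof.
move=> tu; split.
  move=> [k [l [kl ekl h]]]; have [i [j kl4]] := other_two kl.
  have u4 : uniq [:: i; j; k; l].
    by rewrite -(rot_uniq 2)/= in kl4 *.
  exists i, j, (3 / 4 * (dot (u i) x - dot (u k) x)), (3 / 4 * (dot (u j) x - dot (u k) x)).
  split; [by move: u4 => /=; rewrite !inE; case: eqVneq|by have := h i; lra|by have := h j; lra|].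
  rewrite {1}(tetra_repr4 tu x u4) -ekl (tetra_sum4 tu u4).
  by apply/rowP => c; rewrite !mxE; ring.
move=> [i [j [s [t [ij s0 t0 ->]]]]]; have [k [l u4]] := other_two ij.
have hk m : m != i -> m != j -> dot (u m) (s *: u i + t *: u j) = - 3^-1 * (s + t).
  by move=> mi mj; rewrite !dotE !(tetra_dot tu) (negbTE mi) (negbTE mj); lra.
move: (u4); rewrite /= !inE !negb_or => /and4P[/and3P[_ ik il] /andP[jk jl] kl _].
exists k, l; split => //; first by rewrite !hk// eq_sym.
move=> m; rewrite hk 1?eq_sym//.
have [->|mi] := eqVneq m i; first by rewrite !dotE !(tetra_dot tu) eqxx (negbTE ij); lra.
have [->|mj] := eqVneq m j.
  by rewrite !dotE !(tetra_dot tu) eqxx eq_sym (negbTE ij); lra.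
by rewrite hk.
Qed.

(** Summing the squared edge lengths at one vertex gives [S], which forces all the vertices to have
    the squared norm 3/8 l^2. The inner products follow, and [u] is the normalized family. *)
Lemma T_set_sectors T : T_set T -> exists2 u, tetra u & T = sectors u.
Proof.
move=> [v [v0 [l l0 vl]] ->].
have dots i j : i != j -> dot (v i) (v i) + dot (v j) (v j) - 2 * dot (v i) (v j) = l ^+ 2.
  by move=> ij; rewrite -(vl _ _ ij) enorm_sqr !dotE (dotC (v j)); ring.
have S i : 4 * dot (v i) (v i) + \sum_j dot (v j) (v j) = 3 * l ^+ 2.
  have : \sum_(j | j != i) (dot (v i) (v i) + dot (v j) (v j) - 2 * dot (v i) (v j)) = 3 * l ^+ 2.
    rewrite (eq_bigr (fun=> l ^+ 2)); last by move=> j ji; rewrite dots// eq_sym.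
    by rewrite sumr_const cardC1 card_ord mulr_natl.
  rewrite big_split big_split/= sumr_const cardC1 card_ord /= -mulr_natl sumrN -mulr_sumr.
  have : \sum_j dot (v i) (v j) = 0 by rewrite -dot_sumr v0 dot0r.
  rewrite (bigD1 i)//= [\sum_j dot (v j) (v j)](bigD1 i)//=; lra.
pose r2 := 3 / 8 * l ^+ 2.
have vv i : dot (v i) (v i) = r2.
  have e j : dot (v j) (v j) = dot (v i) (v i) by have := S i; have := S j; lra.
  have := S i; rewrite (eq_bigr _ (fun j _ => e j)) sumr_const card_ord -mulr_natl /r2; lra.
have vij i j : i != j -> dot (v i) (v j) = - 3^-1 * r2.
  by move=> ij; have := dots _ _ ij; rewrite !vv /r2; lra.
have r20 : 0 < r2 by rewrite mulr_gt0 ?exprn_gt0//; lra.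
pose r := Num.sqrt r2; have r0 : 0 < r by rewrite sqrtr_gt0.
have rr : r * r = r2 by rewrite -expr2 sqr_sqrtr// ltW.
pose u i := r^-1 *: v i.
have vu i : v i = r *: u i by rewrite scalerA divff ?gt_eqF// scale1r.
have tu : tetra u.
  split=> [i|i j ij]; rewrite dotZl dotZr ?vv ?vij// -rr; field; rewrite gt_eqF//.
exists u => //; apply/seteqP; split => x.
  move=> [t [_ [t0 [i [j [ij [a /= /andP[a0 a1] <-]]]] ->]]].
  apply/sectorsP => //; exists i, j, (t * (1 - a) * r), (t * a * r).
  by rewrite !mulr_ge0 ?subr_ge0 ?(ltW r0)//; split => //; rewrite !vu scalerDr !scalerA.
move=> /sectorsP -/(_ tu) [i [j [s [t [ij s0 t0 ->]]]]].
have [st|st] := eqVneq (s + t) 0.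
  have -> : s = 0 by lra.
  have -> : t = 0 by lra.
  exists 0, (v i); split => //; last by rewrite !scale0r addr0.
  exists i, j; split => //; exists 0; first by rewrite /= lexx ler01.
  by rewrite subr0 scale1r scale0r addr0.
have st0 : 0 < s + t by rewrite lt_neqAle eq_sym st addr_ge0.
exists ((s + t) / r), ((1 - t / (s + t)) *: v i + (t / (s + t)) *: v j); split.
- by rewrite divr_ge0 ?ltW.
- exists i, j; split => //; exists (t / (s + t)) => //=.
  by rewrite divr_ge0 ?(ltW st0)//= ler_pdivrMr// mul1r lerDr.
rewrite !vu scalerDr !scalerA; congr (_ *: _ + _ *: _); field; rewrite ?gt_eqF//.
Qed.

End Tetrahedron.

Section YPoints.
Context {R : realType}.
Implicit Types (x y z : pt R) (u : 'I_4 -> pt R).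

(** Tangent cone of [sectors u] at [u i]: the form of index [i] is far from minimal there, so only
    the three others compete. *)
Definition Y_at u i : set (pt R) := [set z | exists k l : 'I_4,
  [/\ k != l, k != i, l != i, dot (u k) z = dot (u l) z &
      forall m, m != i -> dot (u k) z <= dot (u m) z]].

Lemma Y_set_Y_at u i : tetra u -> Y_set (Y_at u i).
Proof.
(* [K] normalizes u j + u i / 3, the component of u j orthogonal to u i, whose squared norm is 8 /
   9. *)
move=> tu; pose K : R := 3 / (2 * Num.sqrt 2).
have s2 : 0 < Num.sqrt 2 :> R by rewrite sqrtr_gt0.
have K0 : 0 < K by rewrite divr_gt0// mulr_gt0.
have K2 : K * K = 9 / 8.
  have : Num.sqrt 2 * Num.sqrt 2 = 2 :> R by rewrite -expr2 sqr_sqrtr.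
  move=> e; transitivity (9 / (4 * (Num.sqrt 2 * Num.sqrt 2)) : R).
    by rewrite /K; field; rewrite gt_eqF.
  by rewrite e; lra.
pose e (c : 'I_3) := K *: (u (lift i c) + 3^-1 *: u i).
have li c : (lift i c == i) = false by rewrite eq_sym (negbTE (neq_lift i c)).
have il c : (i == lift i c) = false by rewrite (negbTE (neq_lift i c)).
exists 0, (u i), e; split.
- exact: tetra_norm.
- move=> c; split; last first.
    by rewrite /e !dotE !(tetra_dot tu) eqxx il; lra.
  rewrite /enorm -[RHS]sqrtr1; congr Num.sqrt.
  rewrite /e !dotE !(tetra_dot tu) !eqxx li il.
  transitivity (8 / 9 * (K * K)); first by field.
  by rewrite K2; lra.
- move=> c d cd; rewrite /e !dotE !(tetra_dot tu) !eqxx (inj_eq lift_inj) (negbTE cd).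
  rewrite li il.
  transitivity (- (4 / 9) * (K * K)); first by field.
  by rewrite K2; lra.
apply/seteqP; split => z.
  move=> [k [l [kl ki li' ekl hm]]].
  have [j jn] := @exists_notin [:: i; k; l] isT.
  move: jn; rewrite !inE !negb_or => /and3P[ji jk jl].
  have u4 : uniq [:: i; j; k; l].
    by rewrite /= !inE !negb_or kl jk jl !(eq_sym i) ji ki li'.
  have [c jc] : exists c, j = lift i c.
    by case: (unliftP i j) ji => [c ->|->]; [exists c|rewrite eqxx].
  exists c => //.
  pose t := 3 / 4 * (dot (u j) z - dot (u k) z).
  exists (3 / 4 * (dot (u i) z - dot (u k) z) - t / 3), (t / K); split.
    by rewrite divr_ge0 ?(ltW K0)// mulr_ge0// subr_ge0 hm.
  rewrite /e -jc scalerA divfK ?gt_eqF//.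
  rewrite {1}(tetra_repr4 tu z u4) -ekl (tetra_sum4 tu u4) /t.
  by apply/rowP => ?; rewrite !mxE; field.
move=> [c _ [s [t [t0 ->]]]]; set j := lift i c.
have ij : i != j by exact: neq_lift.
have [k [l u4]] := other_two ij.
move: (u4); rewrite /= !inE !negb_or => /and4P[/and3P[_ ik iL] /andP[jk jl] kl _].
have hm m : m != i -> m != j ->
    dot (u m) (0 + s *: u i + t *: e c) = - 3^-1 * s - 4 / 9 * (t * K).
  by move=> mi mj; rewrite /e -/j !dotE !(tetra_dot tu) (negbTE mi) (negbTE mj); field.
exists k, l; split => //; rewrite 1?eq_sym//; first by rewrite !hm// eq_sym.
move=> m mi; rewrite [leLHS]hm 1?eq_sym//.
have [->|mj] := eqVneq m j; last by rewrite hm.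
rewrite /e -/j !dotE !(tetra_dot tu) eqxx eq_sym (negbTE ij).
by have := mulr_ge0 t0 (ltW K0); lra.
Qed.

(** At [u i] the form of index [i] is 1 and the others are -1/3. Changing each of them by less than
    1/3 does not close the gap, so the least value is attained among the other three. *)
Lemma sectors_near_vertex u i z (e : R) : tetra u -> 0 < e -> e * enorm z < 3^-1 ->
  sectors u (u i + e *: z) <-> Y_at u i z.
Proof.
move=> tu e0 ez.
have bnd m : `|e * dot (u m) z| < 3^-1.
  rewrite normrM gtr0_norm// (le_lt_trans _ ez)// ler_wpM2l ?(ltW e0)//.
  by rewrite (le_trans (normr_dot_le _ _))// (tetra_norm tu) mul1r.
have hm m : m != i -> dot (u m) (u i + e *: z) = - 3^-1 + e * dot (u m) z.
  by move=> mi; rewrite dotDr dotZr (tetra_dot tu) (negbTE mi).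
have hi m : m != i -> dot (u m) (u i + e *: z) < dot (u i) (u i + e *: z).
  move=> mi; rewrite hm// dotDr dotZr tu.1.
  by have := bnd m; have := bnd i; rewrite !ltr_norml => /andP[? ?] /andP[? ?]; lra.
split.
  move=> [k [l [kl ekl h]]].
  have ki : k != i.
    apply/eqP => ki; have li : l != i by rewrite eq_sym -ki.
    by have := hi _ li; rewrite -ekl ki ltxx.
  have li : l != i.
    by apply/eqP => li; have := hi _ ki; rewrite ekl li ltxx.
  exists k, l; split => //.
    by move: ekl; rewrite !hm// => /addrI/(mulfI (lt0r_neq0 e0)).
  by move=> m mi; have := h m; rewrite !hm// lerD2l ler_pM2l.
move=> [k [l [kl ki li ekl h]]]; exists k, l; split => //; first by rewrite !hm// ekl.
move=> m; have [->|mi] := eqVneq m i; first exact/ltW/hi.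
by rewrite !hm// lerD2l ler_pM2l// h.
Qed.

Lemma excess_eq0 (r : R) (A B : set (pt R)) :
  A `&` open_ball 0 r `<=` B -> excess 0 r A B = 0%E.
Proof.
move=> AB; apply/eqP; rewrite eq_le; apply/andP; split; last first.
  by apply: ereal_sup_ubound; left.
apply: ge_ereal_sup => _ [->//|[z /AB Bz <-]].
by apply: ereal_inf_lbound; exists z => //; rewrite subrr enorm0.
Qed.

(** The cone coincides with its tangent cone near [u i], so for the radii 1 / (k + 1) the relative
    distance is eventually equal to 0. *)
Lemma type_Y_vertex u i : tetra u -> type_Y (sectors u) (u i).
Proof.
move=> tu; split.
  have [j] := @exists_notin [:: i] isT; rewrite inE => ji.
  apply/sectorsP => //; exists i, j, 1, 0; split => //; first by rewrite eq_sym.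
  by rewrite scale1r scale0r addr0.
exists (Y_at u i); first exact: Y_set_Y_at.
exists (fun k => k.+1%:R^-1); split.
- by move=> k; rewrite invr_gt0.
- exact: cvg_harmonic.
move=> r r0; apply: cvg_near_cst.
exists (Num.truncn (3 * r)).+1 => // k /= kr.
have rk : k.+1%:R^-1 * r < 3^-1.
  rewrite mulrC ltr_pdivrMr ?ltr0n// ltr_pdivlMl//.
  rewrite (lt_trans (truncnS_gt _))// ltr_nat ltnS; exact: kr.
have near z : enorm z < r -> k.+1%:R^-1 * enorm z < 3^-1.
  by move=> zr; rewrite (lt_trans _ rk)// ltr_pM2l.
rewrite /drel !excess_eq0 ?maxxx ?mule0//.
  move=> z [Yz]; rewrite /open_ball/= subr0 => zr.
  exists (u i + k.+1%:R^-1 *: z); last first.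
    by rewrite addrC addKr scalerA invrK mulfV ?scale1r ?pnatr_eq0.
  by apply/sectors_near_vertex => //; exact: near.
move=> _ [[w Tw <-]]; rewrite /open_ball/= subr0 => zr.
have /(sectors_near_vertex i tu) <- := near _ zr; last by rewrite invr_gt0.
by rewrite scalerA mulfV ?pnatr_eq0// scale1r addrC subrK.
Qed.

Lemma tetra_inj u : tetra u -> injective u.
Proof.
move=> tu i j e; have := tu.1 i; rewrite {2}e (tetra_dot tu).
by case: eqVneq => // _ {e} h; exfalso; lra.
Qed.

(** The bijection [y] fixes the number of these points to four; the four distinct vectors [u i] are
    among them, hence exhaust them, without a study of the blow-ups at other points. *)
Lemma Y_points_sectors u (y : 'I_4 -> pt R) : tetra u ->
  set_bij [set: 'I_4] (Y_points (sectors u)) y -> Y_points (sectors u) = range u.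
Proof.
move=> tu [yY yinj ysurj].
have Yu i : Y_points (sectors u) (u i).
  by split; [exact: type_Y_vertex|exact: tetra_norm].
have /choice[s ys] : forall i, exists j, y j = u i.
  by move=> i; have [j _ <-] := ysurj _ (Yu i); exists j.
have sinj : injective s.
  by move=> i j e; apply: (tetra_inj tu); rewrite -!ys e.
apply/seteqP; split => [x Yx|_ [i _ <-]//].
have [j _ <-] := ysurj _ Yx.
by exists (invF sinj j) => //; rewrite -ys f_invF.
Qed.

End YPoints.

Section SolidTetrahedron.
Context {R : realType}.
Implicit Types (x y z : pt R) (u : 'I_4 -> pt R).

Lemma convex_setP (M : set (pt R)) : @convex_set R (pt R) M <->
  forall x y (a b : R), M x -> M y -> 0 <= a -> 0 <= b -> a + b = 1 -> M (a *: x + b *: y).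
Proof.
split=> [cM x y a b Mx My a0 b0 ab|h x y l /set_mem Mx /set_mem My].
  have a1 : a <= 1 by rewrite -ab lerDl.
  have /set_mem := cM x y (Itv01 a0 a1) (mem_set Mx) (mem_set My).
  by rewrite /conv/= /unstable.onem -ab [a + b]addrC addrK.
by apply/mem_set/h => //; rewrite ?subr_ge0// /unstable.onem addrC subrK.
Qed.

Lemma convex_hull_tetra u : tetra u ->
  convex_hull (range u) = [set z | gaugeT u z <= 1].
Proof.
move=> tu; apply/seteqP; split => z.
  apply; split; last first.
    move=> _ [i _ <-]; apply/gaugeT_leP => k; rewrite (tetra_dot tu).
    by case: eqP => _; lra.
  apply/convex_setP => x y a b /gaugeT_leP hx /gaugeT_leP hy a0 b0 ab.
  apply/gaugeT_leP => k; rewrite dotDr !dotZr.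
  by have := hx k; have := hy k; nra.
move=> /gaugeT_leP hz M [/convex_setP cM uM].
(* [w] lies in [s] times [M], with the case s = 0 apart since partial sums of barycentric
   coordinates may vanish. In this form membership passes through the sum by induction. *)
pose cone_over (s : R) w := 0 <= s /\ (s = 0 /\ w = 0 \/ 0 < s /\ M (s^-1 *: w)).
have coneD s t w v : cone_over s w -> cone_over t v -> cone_over (s + t) (w + v).
  move=> [s0 hs] [t0 ht]; split; first by rewrite addr_ge0.
  case: hs => [[-> ->]|[sp Ms]]; first by rewrite !add0r.
  case: ht => [[-> ->]|[tp Mt]]; first by rewrite !addr0; right.
  right; have st : 0 < s + t by rewrite addr_gt0.
  split => //; have -> : (s + t)^-1 *: (w + v) =
      (s / (s + t)) *: (s^-1 *: w) + (t / (s + t)) *: (t^-1 *: v).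
    by rewrite scalerDr !scalerA ![_ / (s + t)]mulrC -!mulrA !mulfV ?gt_eqF// !mulr1.
  apply: cM => //; rewrite ?divr_ge0 ?(ltW st)//.
  by rewrite -mulrDl mulfV ?gt_eqF.
pose l k := (1 + 3 * dot (u k) z) / 4.
have l0 k : 0 <= l k by rewrite /l; have := hz k; lra.
have conel k : cone_over (l k) (l k *: u k).
  split => //; have [->|lk] := eqVneq (l k) 0; first by left; rewrite scale0r.
  right; split; first by rewrite lt_neqAle eq_sym lk l0.
  by rewrite scalerA mulVf// scale1r; apply: uM; exists k.
have : cone_over (\sum_k l k) (\sum_k l k *: u k).
  elim/big_rec2: _ => [|k s w _ h]; first by split => //; left.
  exact: coneD.
have -> : \sum_k l k = 1.
  rewrite -mulr_suml big_split/= -mulr_sumr (dot_sum0 tu) sumr_const card_ord -mulr_natl.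
  by lra.
have -> : \sum_k l k *: u k = z.
  rewrite [RHS](tetra_repr tu z) scaler_sumr.
  rewrite (eq_bigr (fun k => 4^-1 *: u k + (3 / 4) *: (dot (u k) z *: u k))).
    by rewrite big_split/= -scaler_sumr (tetra_sum0 tu) scaler0 add0r.
  by move=> k _; rewrite scalerA -scalerDl; congr (_ *: _); rewrite /l; field.
by move=> [_ [[/eqP]|[_]]]; rewrite ?oner_eq0// invr1 scale1r.
Qed.

End SolidTetrahedron.

(** * Area comparison *)

Section Areas.
Context {R : realType}.
Implicit Types (x y z : pt R) (u : 'I_4 -> pt R).

Lemma H2_bigcup_fin (I : finType) (F : I -> set (pt R)) :
  (forall i, H2 (F i) < +oo)%E -> (H2 (\bigcup_i F i) < +oo)%E.
Proof.
move=> hF; have /le_H2/le_lt_trans : \bigcup_i F i `<=` \bigcup_(i in [set` enum I]) F i.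
  by move=> x [i _ Fx]; exists i => //=; rewrite mem_enum.
apply; rewrite bigcup_seq; elim/big_ind: _ => [|A B hA hB|//].
  by rewrite H2_set0 ltry.
by rewrite (le_lt_trans (H2U _ _))// lte_add_pinfty.
Qed.

Lemma H2_strong_additive (A B : set (pt R)) : closed A ->
  (H2 A + H2 B = H2 (A `|` B) + H2 (A `&` B))%E.
Proof.
move=> cA; have mA := closed_caratheodory cA.
have := mA (A `|` B); rewrite /H2o/= => ->.
have -> : (A `|` B) `&` A = A.
  by apply/seteqP; split => x; [case|move=> Ax; split => //; left].
have := mA B; rewrite /H2o/= => ->.
rewrite -addeA; congr (_ + _)%E; rewrite addeC setIC; congr (_ + _)%E.
by congr H2; apply/seteqP; split => x /= [h nA]; split => //; [right|case: h].
Qed.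

Variables (u : 'I_4 -> pt R) (tu : tetra u).

Let C := [set z | gaugeT u z <= 1].
Let TC := sectors u `&` C.

(** The index [lift k c] runs through those other than [k]. In [C], the distance to the face
    opposite to [u k] is dot (u k) x + 1/3, so minimality of [k] means that this face is a nearest
    one. *)
Definition sector_part k : set (pt R) := C `&` \bigcup_(c in [set: 'I_3])
  [set x | dot (u k) x = dot (u (lift k c)) x /\ forall m, dot (u k) x <= dot (u m) x].

Lemma closed_solid : closed C.
Proof. exact/closed_le_continuous/continuous_maxdot. Qed.

Lemma compact_solid : compact C.
Proof.
apply: (@bounded_closed_compact_enorm _ _ 1); first exact: closed_solid.
by move=> x; apply: le_trans; exact: enorm_le_gaugeT.
Qed.

Lemma closed_dot_le (a : pt R) (c : R) : closed [set x | dot a x <= c].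
Proof. exact/closed_le_continuous/continuous_dot. Qed.

Lemma closed_sector_part k : closed (sector_part k).
Proof.
apply: closedI; first exact: closed_solid.
apply: closed_bigcup => [|c _]; first exact: finite_finset.
have -> : [set x | dot (u k) x = dot (u (lift k c)) x /\ forall m, dot (u k) x <= dot (u m) x]
  = [set x | dot (u (lift k c) - u k) x <= 0] `&`
    \bigcap_m [set x | dot (u k - u m) x <= 0].
  apply/seteqP; split => x /=.
    move=> [e h]; split; first by rewrite dotBl e subrr.
    by move=> m _ /=; rewrite dotBl subr_le0.
  rewrite dotBl subr_le0 => -[h1 h2].
  have h m : dot (u k) x <= dot (u m) x by rewrite -subr_le0 -dotBl; exact: h2.
  by split => //; apply/eqP; rewrite eq_le h1 h.
apply: closedI; first exact: closed_dot_le.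
by apply: closed_bigI => m _; exact: closed_dot_le.
Qed.

Lemma sector_part_sub k : sector_part k `<=` TC.
Proof.
move=> x [Cx [c _ [e h]]]; split => //; exists k, (lift k c); split => //.
exact: neq_lift.
Qed.

Lemma H2_sectors_solid : (H2 TC < +oo)%E.
Proof.
apply: (@le_lt_trans _ _ (H2 (\bigcup_p parallelogram 0 (u p.1) (u p.2)))); last first.
  by apply: H2_bigcup_fin => p; exact: H2_parallelogram.
apply: le_H2 => x [/sectorsP-/(_ tu)[i [j [s [t [ij s0 t0 ex]]]]] /gaugeT_leP hx].
exists (i, j) => //; exists s, t; rewrite add0r; split => //.
- have [k [l u4]] := other_two ij.
  move: (u4); rewrite /= !inE !negb_or => /and4P[/and3P[_ ik il] /andP[jk jl] kl _].
  have := hx k; rewrite ex !dotE !(tetra_dot tu) eq_sym (negbTE ik) eq_sym (negbTE jk).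
  by rewrite s0/=; lra.
- have [k [l u4]] := other_two ij.
  move: (u4); rewrite /= !inE !negb_or => /and4P[/and3P[_ ik il] /andP[jk jl] kl _].
  have := hx k; rewrite ex !dotE !(tetra_dot tu) eq_sym (negbTE ik) eq_sym (negbTE jk).
  by rewrite t0/=; lra.
Qed.

(** Three equal forms put [x] on the line through the fourth vertex, whose direction is also that of
    u i + u j + u k. *)
Lemma H2_axis i j k : uniq [:: i; j; k] ->
  H2 [set x | [/\ C x, dot (u i) x = dot (u j) x & dot (u j) x = dot (u k) x]] = 0%E.
Proof.
move=> u3; apply: H2_null_subset (H2_bounded_line 0 (u i + u j + u k) 3).
move=> x [Cx ij jk].
have [l] := @exists_notin [:: i; j; k] isT.
rewrite !inE !negb_or => /and3P[li lj lk].
have u4 : uniq [:: i; j; k; l].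
  by move: u3; rewrite /= !inE !negb_or !(eq_sym _ l) li lj lk => /and3P[/andP[-> ->] -> _].
have s4 := dot_sum4 tu x u4.
exists (3 / 4 * (dot (u i) x - dot (u l) x)).
  have bnd m : `|dot (u m) x| <= 1.
    rewrite (le_trans (normr_dot_le _ _))// (tetra_norm tu) mul1r.
    by rewrite (le_trans (enorm_le_gaugeT tu _)).
  have := bnd i; have := bnd l; rewrite !ler_norml => /andP[? ?] /andP[? ?].
  by apply/andP; split; lra.
rewrite {1}(tetra_repr4 tu x u4) (tetra_sum4 tu u4) -jk -ij add0r.
by apply/rowP => c; rewrite !mxE; ring.
Qed.

Lemma sector_part_pair k x : sector_part k x ->
  exists l, [/\ l != k, C x, dot (u k) x = dot (u l) x & forall m, dot (u k) x <= dot (u m) x].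
Proof.
by move=> [Cx [c _ [e h]]]; exists (lift k c); split => //; rewrite eq_sym neq_lift.
Qed.

Lemma sector_part_eq k l x : sector_part k x -> sector_part l x -> dot (u k) x = dot (u l) x.
Proof.
move=> /sector_part_pair[k' [_ _ _ hk]] /sector_part_pair[l' [_ _ _ hl]].
by apply/eqP; rewrite eq_le hk hl.
Qed.

(* A generic point of [TC] lies in exactly two of the four sets [sector_part k]. *)
Lemma sum_sector_part : (\sum_k H2 (sector_part k) <= H2 TC + H2 TC)%E.
Proof.
have triple i j k : uniq [:: i; j; k] ->
    H2 (sector_part i `&` sector_part j `&` sector_part k) = 0%E.
  move=> u3; apply: H2_null_subset (H2_axis u3) => x [[hi hj] hk]; split.
  - by case: hi.
  - exact: sector_part_eq.
  - exact: sector_part_eq.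
have pairs i j k l : uniq [:: i; j; k; l] ->
    (H2 (sector_part i `|` sector_part j) + H2 (sector_part k `&` sector_part l) <= H2 TC)%E.
  have cij : closed (sector_part i `|` sector_part j).
    by apply: (@closedU (pt R)); exact: closed_sector_part.
  move=> u4; rewrite (H2_strong_additive _ cij).
  rewrite [X in (_ + X)%E](_ : _ = 0%E) ?adde0.
    apply: le_H2 => x [[|]|[+ _]]; exact: sector_part_sub.
  move: u4; rewrite /= !inE !negb_or => /and4P[/and3P[ij ik il] /andP[jk jl] kl _].
  apply: (@H2_null_subset _ _ (
    (sector_part i `&` sector_part k `&` sector_part l) `|`
    (sector_part j `&` sector_part k `&` sector_part l))).
    by move=> x [[h|h] [hk hl]]; [left|right].
  by apply: H2_nullU; apply: triple; rewrite /= !inE ?negb_or ?ik ?il ?jk ?jl ?kl.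
(* The two strong additivities are regrouped crosswise: the union of parts 0 and 1 goes with the
   intersection of parts 2 and 3, and conversely. The two members of such a group overlap in triple
   intersections, which are null. *)
rewrite (@sum_four _ _ 0 1 2 3)// (H2_strong_additive _ (closed_sector_part (k := 0))).
rewrite -addeA (H2_strong_additive _ (closed_sector_part (k := 2))).
rewrite [X in (_ + X)%E]addeC addeACA [X in (_ + X)%E]addeC.
by apply: leeD; exact: pairs.
Qed.

(** Along [u k] the form of index [k] grows at speed 1 and the others decrease at speed 1/3; from a
    point of the face, [a] is the time at which form [k] meets the least of the others. *)
Lemma solid_bdry_face k z : gaugeT u z = 1 -> 3 * dot (u k) z = - 1 ->
  exists2 x, sector_part k x & z = x - (dot (u k) x + 3^-1) *: u k.
Proof.
move=> z1 zk; have hz m : - 1 <= 3 * dot (u m) z by have := gaugeT_ge u z m; rewrite z1.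
have [c _ hc] := @arg_minP _ _ _ (ord0 : 'I_3) xpredT (fun c => dot (u (lift k c)) z) isT.
set l := lift k c in hc *.
pose a := 3 / 4 * (dot (u l) z + 3^-1).
have a0 : 0 <= a by rewrite mulr_ge0//; have := hz l; lra.
have hm m : m != k -> dot (u m) (z + a *: u k) = dot (u m) z - a / 3.
  by move=> mk; rewrite dotDr dotZr (tetra_dot tu) (negbTE mk); field.
have hk : dot (u k) (z + a *: u k) = - 3^-1 + a.
  by rewrite dotDr dotZr tu.1; lra.
have lk : l != k by rewrite eq_sym neq_lift.
have kmin m : dot (u k) (z + a *: u k) <= dot (u m) (z + a *: u k).
  have [->//|mk] := eqVneq m k; rewrite hk hm//.
  have [d md] : exists d, m = lift k d.
    by case: (unliftP k m) mk => [d ->|->]; [exists d|rewrite eqxx].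
  have := hc d isT; rewrite -md /a; lra.
exists (z + a *: u k); last first.
  rewrite hk -addrA -scalerBl -[LHS]addr0 -(scale0r (u k)); congr (_ + _ *: _); lra.
split; last first.
  by exists c => //; split => //; rewrite -/l hk hm// /a; lra.
by apply/gaugeT_leP => m; have := kmin m; rewrite hk; lra.
Qed.

Let face k := [set z | gaugeT u z = 1 /\ 3 * dot (u k) z = - 1].

Lemma H2_face k : (H2 (face k) <= H2 (sector_part k))%E.
Proof.
apply: le_trans (H2_contraction (f := fun x => x - (dot (u k) x + 3^-1) *: u k) _).
  by apply: le_H2 => z [z1 /(solid_bdry_face z1)[x kx ->]]; exists x.
move=> x y _ _.
have -> : x - (dot (u k) x + 3^-1) *: u k - (y - (dot (u k) y + 3^-1) *: u k) =
    (x - y) - dot (u k) (x - y) *: u k.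
  by rewrite dotBr; apply/rowP => c; rewrite !mxE; ring.
move: (x - y) => w; rewrite -(@ler_pXn2r _ 2)// ?nnegrE ?enorm_ge0// !enorm_sqr.
rewrite !dotE tu.1 (dotC w (u k)); have := sqr_ge0 (dot (u k) w); lra.
Qed.

Lemma H2_solid_bdry : (H2 [set z | gaugeT u z = 1%R] <= H2 TC + H2 TC)%E.
Proof.
apply: le_trans sum_sector_part.
apply: (@le_trans _ _ (\sum_k H2 (face k))%E); last first.
  by apply: lee_sum => k _; exact: H2_face.
rewrite (@sum_four _ _ 0 1 2 3)//.
have sub : [set z | gaugeT u z = 1] `<=` face 0 `|` face 1 `|` face 2 `|` face 3.
  move=> z z1; have [k hk] := maxdot_eq (fun k => - 3 *: u k) z.
  have Fk : face k z.
    by split => //; move: hk; rewrite -/(gaugeT u z) z1 dotZl; lra.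
  have := @mem_four 0 1 2 3 isT k; rewrite !inE => /or4P[] /eqP e; rewrite e in Fk.
  - by left; left; left.
  - by left; left; right.
  - by left; right.
  - by right.
apply: le_trans (le_H2 sub) _; apply: le_trans (H2U _ _) _; apply: leeD2r.
by apply: le_trans (H2U _ _) _; apply: leeD2r; exact: H2U.
Qed.

End Areas.

(** * Pushing along the boundary of the tetrahedron *)

Section Push.
Context {R : realType}.
Implicit Types (x y z q : pt R) (G E K : set (pt R)).

Lemma compact_pos_lower_bound K (p : pt R -> R) : compact K -> continuous p ->
  (forall x, K x -> 0 < p x) -> exists2 c : R, 0 < c & forall x, K x -> c <= p x.
Proof.
move=> cK cp p0.
have cpK : closed (p @` K).
  apply: compact_closed; first exact: Rhausdorff.
  by apply: continuous_compact => //; apply: continuous_subspaceT.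
have : nbhs (0 : R) (~` (p @` K)).
  have : open (~` (p @` K)) by exact: closed_openC.
  by rewrite openE; apply; move=> [x Kx px]; have := p0 _ Kx; rewrite px ltxx.
move=> /nbhs_ballP[c c0 h]; exists c => // x Kx; rewrite leNgt; apply/negP => pc.
apply: (h (p x)); last by exists x.
by rewrite /ball/= sub0r normrN gtr0_norm// p0.
Qed.

Lemma orth3_span (e : 'I_3 -> pt R) v : (forall i j, i != j -> dot (e i) (e j) = 0) ->
  (forall i, e i <> 0) -> (forall i, dot (e i) v = 0) -> v = 0.
Proof.
move=> eo e0 ev; pose M : 'M[R]_3 := \matrix_i e i.
pose B : 'M[R]_3 := \matrix_(i, j) (e j 0 i / dot (e j) (e j)).
have MB : M *m B = 1%:M.
  apply/matrixP => i j; rewrite !mxE.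
  transitivity (dot (e i) (e j) / dot (e j) (e j)).
    by rewrite /dot mulr_suml; apply: eq_bigr => k _; rewrite !mxE mulrA.
  have [->|ij] := eqVneq i j; last by rewrite eo// mul0r.
  by rewrite divff//; apply/eqP => /dot_eq0; exact: e0.
have [Mu _] := mulmx1_unit MB.
have Mv : M *m v^T = 0.
  apply/matrixP => i j; rewrite !mxE -[RHS](ev i).
  by apply: eq_bigr => k _; rewrite !mxE (ord1 j).
by apply: trmx_inj; rewrite trmx0 -(mulKmx Mu v^T) Mv mulmx0.
Qed.

(** For [a] parallel to [n] the set is empty because c is nonzero. Otherwise it lies on a line,
    found from two of its points if there are two: [b], the part of [a] orthogonal to [n], completes
    [n] and [d] to an orthogonal basis. *)
Lemma H2_plane_cap_plane (n a : pt R) (c : R) : enorm n = 1 -> a <> 0 -> c != 0 ->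
  H2 [set z | [/\ enorm z <= 1, dot n z = c & dot a z = 0]] = 0%E.
Proof.
move=> n1 a0 c0; set L := (X in H2 X).
have nn : dot n n = 1 by rewrite -enorm_sqr n1 expr1n.
have [[p Lp]|noL] := pselect (L !=set0); last first.
  by apply: H2_null_subset (@H2_set0 R) => z Lz; apply: noL; exists z.
have [[p' [Lp' pp']]|onlyp] := pselect (exists p', L p' /\ p' <> p); last first.
  apply: H2_null_subset (H2_bounded_line p 0 0) => z Lz.
  exists 0; first by rewrite normr0.
  by rewrite scale0r addr0; apply: contrapT => zp; apply: onlyp; exists z.
pose d := p' - p; have d0 : d <> 0 by move/eqP; rewrite subr_eq0 => /eqP.
have dd : 0 < dot d d by rewrite -enorm_sqr exprn_gt0// enorm_gt0.
pose b := a - dot n a *: n.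
have b0 : b <> 0.
  move/eqP; rewrite subr_eq0 => /eqP ab; have [_ np ap] := Lp.
  move: ap; rewrite ab dotZl np => /eqP; rewrite mulf_eq0 (negbTE c0) orbF => /eqP na.
  by apply: a0; rewrite ab na scale0r.
have perp z : L z -> dot n (z - p) = 0 /\ dot b (z - p) = 0.
  move=> [_ nz az]; have [_ np ap] := Lp.
  by rewrite /b dotBl dotZl !dotBr nz az np ap !subrr mulr0 subrr.
have nb : dot n b = 0 by rewrite /b dotBr dotZr nn mulr1 subrr.
have [nd bd] := perp _ Lp'; rewrite -/d in nd bd.
apply: H2_null_subset (H2_bounded_line p d (2 * enorm d / dot d d)) => z Lz.
exists (dot d (z - p) / dot d d).
  rewrite normrM normfV (gtr0_norm dd) ler_wpM2r ?invr_ge0 ?(ltW dd)//.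
  rewrite (le_trans (normr_dot_le _ _))// mulrC ler_wpM2r ?enorm_ge0//.
  case: Lz => z1 _ _; case: Lp => p1 _ _.
  by rewrite (le_trans (enormD _ _))// enormN; lra.
have [nz bz] := perp _ Lz.
apply/eqP; rewrite -subr_eq0 opprD addrA; apply/eqP; move: (z - p) nz bz => v nz bz.
apply: (@orth3_span (fun i : 'I_3 => nth 0 [:: n; b; d] i)).
- by move=> [[|[|[|//]]] ?] [[|[|[|//]]] ?]//= _; rewrite // dotC.
- move=> [[|[|[|//]]] ?]//= n0.
  by move: n1; rewrite n0 enorm0 => /eqP; rewrite eq_sym oner_eq0.
- move=> [[|[|[|//]]] ?]/=; rewrite dotBr dotZr ?nz ?bz ?nd ?bd ?mulr0 ?subrr//.
  by rewrite divfK ?subrr// gt_eqF.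
Qed.

Variables (u : 'I_4 -> pt R) (tu : tetra u).
Let N := gaugeT u.
Let S := [set z | N z = 1].

Lemma gauge_norm1 z : enorm z <= 1 * N z.
Proof. by rewrite mul1r; exact: enorm_le_gaugeT. Qed.

Lemma gauge_ge0 z : 0 <= N z.
Proof. exact: le_trans (enorm_ge0 z) (enorm_le_gaugeT tu z). Qed.

(** No face plane contains the origin, so a plane through the origin cuts each of them in at most a
    line. Pushed points will land on such planes. *)
Lemma H2_bdry_cap_plane a : a <> 0 -> H2 (S `&` [set z | dot a z = 0]) = 0%E.
Proof.
move=> a0.
pose L k := [set z | [/\ enorm z <= 1, dot (u k) z = - 3^-1 & dot a z = 0]].
have L0 k : H2 (L k) = 0%E.
  apply: (@H2_plane_cap_plane (u k) a (- 3^-1) (tetra_norm tu k) a0).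
  by rewrite oppr_eq0 invr_eq0 pnatr_eq0.
apply: (@H2_null_subset _ _ (L 0 `|` L 1 `|` L 2 `|` L 3)).
  move=> z [z1 az]; have [k hk] := maxdot_eq (fun k => - 3 *: u k) z.
  have Lk : L k z.
    split => //; first by rewrite -z1 enorm_le_gaugeT.
    by move: hk; rewrite -/(gaugeT u z) -/N z1 dotZl; lra.
  have := @mem_four 0 1 2 3 isT k; rewrite !inE => /or4P[] /eqP e; rewrite e in Lk.
  - by left; left; left.
  - by left; left; right.
  - by left; right.
  - by right.
by do !apply: H2_nullU.
Qed.

(** Cones replace balls as neighbourhoods on the boundary: radial rescaling keeps the signs of the
    forms, and a point leaves the cone through a plane containing the origin. *)
Definition open_cone (a : 'I_4 -> pt R) : set (pt R) := [set z | forall k, 0 < dot (a k) z].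

Lemma thin_cone q (r : R) : S q -> 0 < r -> exists a (s : R),
  [/\ open_cone a q, 0 < s <= 1 &
      forall z, open_cone a z -> `|N z - 1| < s -> enorm (z - q) < r].
Proof.
move=> q1 r0.
have q0 : q <> 0.
  move=> q0; move: q1; rewrite /S/= q0 -(scale0r 0) /N /gaugeT maxdotZ// mul0r => /eqP.
  by rewrite eq_sym oner_eq0.
have nq := enorm_gt0 q0.
have nq1 : enorm q <= 1 by rewrite -q1 enorm_le_gaugeT.
have qq : dot q q = enorm q * enorm q by rewrite -enorm_sqr.
have qq0 : 0 < dot q q by rewrite qq mulr_gt0.
have [L L0 hL] := slip_maxdot (fun k => - 3 *: u k).
(* The final estimate is enorm (z - q) < s + 6 kap (1 + L), where both terms are at most r / 4. *)
pose kap := r / (24 * (1 + L)).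
have kap0 : 0 < kap by rewrite divr_gt0// mulr_gt0// ltr_pwDl.
(* The second term is the component of [u k] orthogonal to [q]. These components sum to 0, and [kap]
   controls the opening of the cone around [q]. *)
pose a k := kap *: q + (u k - (dot (u k) q / dot q q) *: q).
pose s := Num.min 1 (r / 4).
exists a, s; split.
- move=> k; rewrite /a !dotE divfK ?gt_eqF// subrr addr0 mulr_gt0//.
- by rewrite /s lt_min ltr01 divr_gt0//= ge_min lexx.
move=> z hz zs.
have sr : s <= r / 4 by rewrite ge_min lexx orbT.
have s1 : s <= 1 by rewrite ge_min lexx.
pose t := dot q z / dot q q; pose w := z - t *: q.
have az k : dot (a k) z = kap * dot q z + dot (u k) w.
  by rewrite /a /w /t !dotE; field; rewrite gt_eqF.
have qz : 0 < dot q z.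
  have : 0 < \sum_k dot (a k) z.
    rewrite (bigD1 0)//=; apply: ltr_pwDl; first exact: hz.
    by apply: sumr_ge0 => k _; exact/ltW/hz.
  rewrite (eq_bigr _ (fun k _ => az k)) big_split/= (dot_sum0 tu) addr0.
  by rewrite sumr_const card_ord -mulr_natl pmulr_rgt0// pmulr_rgt0.
have t0 : 0 < t by rewrite divr_gt0.
have wk : enorm w <= 3 * (kap * dot q z).
  apply: le_trans (enorm_le_gaugeT tu w) _; apply/gaugeT_leP => k.
  by have := hz k; rewrite az; lra.
have zN : enorm z <= 2.
  by rewrite (le_trans (enorm_le_gaugeT tu z))//; move: zs; rewrite /N ltr_norml; lra.
have wk' : enorm w <= 6 * kap.
  rewrite (le_trans wk)//.
  have : dot q z <= 2.
    rewrite (le_trans (cauchy_schwarz _ _))// -[leRHS]mul1r.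
    by rewrite ler_pM// enorm_ge0.
  by nra.
have Nt : N (t *: q) = t by rewrite /N /gaugeT maxdotZ ?(ltW t0)// -/(gaugeT u q) -/N q1 mulr1.
have hw : `|N z - t| <= L * (6 * kap).
  rewrite -Nt; apply: le_trans (hL _ _) _; rewrite ler_wpM2l//.
have ht : `|t - 1| < s + L * (6 * kap).
  move: hw zs; rewrite !ltr_norml ler_norml => /andP[? ?] /andP[? ?].
  by apply/andP; split; lra.
have -> : z - q = w + (t - 1) *: q by rewrite /w scalerBl scale1r addrA subrK.
rewrite (le_lt_trans (enormD _ _))// enormZ.
have : `|t - 1| * enorm q <= `|t - 1| by rewrite ler_piMr.
have : kap * (1 + L) = r / 24 by rewrite /kap; field; rewrite gt_eqF// ltr_pwDl.
lra.
Qed.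

(** Points of the cone slide along -q until a first form vanishes, at time [tau0], and are then
    rescaled onto [S]. The factor [cut] confines the motion to the shell where the cone is free of
    [E]. On [S] only [q] itself could slide to the origin; as [q] is not in [G], compactness bounds
    the gauge from below on the image of [G], which makes the rescaling Lipschitz. *)
Lemma push (a : 'I_4 -> pt R) (s : R) q G E : 0 < s <= 1 ->
  S q -> open_cone a q -> compact G -> G `<=` S -> ~ G q ->
  (forall z, open_cone a z -> `|N z - 1| < s -> ~ E z) ->
  exists h, [/\ elip h, forall z, 4 < enorm z -> h z = z,
    forall z, enorm z <= 4 -> enorm (h z) <= 4,
    forall z, E z -> h z = z &
    forall z, G z -> S (h z) /\
     (h z = z /\ ~ open_cone a z \/
      (forall k, 0 <= dot (a k) (h z)) /\ exists k, dot (a k) (h z) = 0)].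
Proof.
move=> /andP[s0 s1] q1 aq cG GS nGq nE.
pose b k := - (dot (a k) q)^-1 *: a k.
pose tau0 z := - maxdot b z.
(* With this slope the cutoff takes on [S] the value [A * s], an upper bound of [tau0] there, and is
   thus inactive on [S]. *)
pose A := enorm (a 0) / dot (a 0) q / s.
have A0 : 0 <= A by rewrite !divr_ge0 ?enorm_ge0// ltW.
pose cut z := A * (s - `|N z - 1|).
pose tau z := Num.max 0 (Num.min (tau0 z) (cut z)).
have Nslip : slip N by exact: slip_maxdot.
have tau_slip : slip tau.
  apply: slip_max; first exact: slip_cst.
  apply: slip_min.
    have : slip (fun z => -1 * maxdot b z) by exact/slip_linear/slip_maxdot.
    by move=> [L L0 hL]; exists L => // x y; have := hL x y; rewrite !mulN1r.
  apply: slip_linear.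
  have : slip (fun z => s + -1 * `|N z + - 1|).
    apply: (@slipD _ (fun=> s)); first exact: slip_cst.
    apply/slip_linear/slip_abs; apply: (@slipD _ N (fun=> -1)) => //.
    exact: slip_cst.
  by move=> [L L0 hL]; exists L => // x y; have := hL x y; rewrite !mulN1r.
have tau_ge0 z : 0 <= tau z by rewrite le_max lexx.
pose g z := z - tau z *: q.
have g_lip : elip g.
  by apply: (@elipD _ id (fun z => - (tau z *: q))); [exact: elip_id|exact/elipN/elip_scale_const].
have tau0_le z k : tau0 z <= dot (a k) z / dot (a k) q.
  by rewrite lerNl (le_trans _ (maxdot_ge b k z))// /b dotZl mulNr mulrC.
have tau0_eq z : exists k, tau0 z = dot (a k) z / dot (a k) q.
  by have [k hk] := maxdot_eq b z; exists k; rewrite /tau0 hk dotZl mulNr opprK mulrC.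
have tauS z : S z -> tau z = Num.max 0 (tau0 z).
  move=> z1; rewrite /tau (min_idPl _)// /cut z1 subrr normr0 subr0 /A divfK ?gt_eqF//.
  rewrite (le_trans (tau0_le z 0))// ler_wpM2r ?invr_ge0 ?(ltW (aq 0))//.
  rewrite (le_trans (cauchy_schwarz _ _))// ler_piMr ?enorm_ge0//.
  by rewrite -z1 enorm_le_gaugeT.
have Ng_gt0 z : G z -> 0 < N (g z).
  move=> Gz; rewrite lt_neqAle gauge_ge0 andbT; apply/eqP => /esym Ng0.
  have gz0 : g z = 0.
    by apply: enorm_eq0; apply/eqP; rewrite eq_le enorm_ge0 andbT -Ng0 enorm_le_gaugeT.
  have zq : z = tau z *: q by apply/eqP; rewrite -subr_eq0; apply/eqP.
  have : N z = 1 by exact: GS.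
  rewrite zq /N /gaugeT maxdotZ// -/(gaugeT u q) -/N q1 mulr1 => t1.
  by apply: nGq; rewrite -(scale1r q) -t1 -zq.
have [c0' c0'0 hc0'] : exists2 c : R, 0 < c & forall x, G x -> c <= N (g x).
  apply: (@compact_pos_lower_bound _ (N \o g)) => //.
  exact/slip_continuous/slip_comp.
pose c := Num.min 1 c0'; have c0 : 0 < c by rewrite lt_min ltr01.
(* The two truncations cancel where [g] does not move the point; on [G] the choice of [c] makes
   [h z] the exact rescaling of [g z] onto [S]. *)
pose h z := z + (rcap N c (g z) - rcap N c z).
have rcap_lip : elip (rcap N c).
  exact: (elip_rcap Nslip c0 ler01 gauge_norm1).
have h_tau0 z : tau z = 0 -> h z = z.
  by move=> t0; rewrite /h /g t0 scale0r subr0 subrr addr0.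
have h_far z : 2 <= N z -> h z = z.
  move=> z2; apply: h_tau0; apply/max_idPl; rewrite ge_min; apply/orP; right.
  rewrite /cut mulr_ge0_le0// ger0_norm; lra.
exists h; split.
- apply: (@elipD _ id _ (@elip_id R)).
  by apply: (@elipD _ (rcap N c \o g)); [exact: elip_comp|exact: elipN].
- by move=> z z4; apply: h_far; have := enorm_le_gaugeT tu z; rewrite -/N; lra.
(* The radius 4 comes from here: where N z < 2, [z] has norm below 2 and each truncated term has
   norm at most 1. *)
- move=> z z4; have [z2|z2] := leP 2 (N z); first by rewrite h_far.
  have := enorm_le_gaugeT tu z; rewrite -/N => zN.
  rewrite (le_trans (enormD _ _))//; have := enormD (rcap N c (g z)) (- rcap N c z).
  rewrite enormN.
  have := enorm_rcap c0 ler01 (gauge_norm1 z); have := enorm_rcap c0 ler01 (gauge_norm1 (g z)).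
  lra.
- move=> z Ez; apply: h_tau0; apply/max_idPl; rewrite leNgt; apply/negP.
  rewrite lt_min => /andP[t0 ct].
  apply: (nE z) => //.
    move=> k; have := lt_le_trans t0 (tau0_le z k).
    by rewrite pmulr_lgt0// invr_gt0.
  rewrite -subr_gt0 ltNge; apply/negP => h0.
  by move: ct; rewrite ltNge mulr_ge0_le0.
move=> z Gz; have Sz : S z by exact: GS.
have hg : h z = (N (g z))^-1 *: g z.
  rewrite /h /rcap (max_idPl _); last by rewrite (le_trans _ (hc0' _ Gz))// ge_min lexx orbT.
  rewrite (max_idPl _); last by rewrite Sz ge_min lexx.
  by rewrite Sz invr1 scale1r addrC subrK.
have Sh : S (h z).
  rewrite /S/= hg /N /gaugeT maxdotZ ?invr_ge0 ?gauge_ge0//.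
  by rewrite mulVf// gt_eqF// Ng_gt0.
split => //; have [az|naz] := pselect (open_cone a z); [right|left].
  have t0 : tau z = tau0 z.
    rewrite tauS//; apply/max_idPr; have [k ->] := tau0_eq z.
    by rewrite divr_ge0// ltW.
  split=> [k|].
    rewrite hg dotZr mulr_ge0 ?invr_ge0 ?gauge_ge0// /g t0 dotBr dotZr subr_ge0.
    by rewrite -ler_pdivlMr.
  have [k hk] := tau0_eq z; exists k.
  by rewrite hg dotZr /g t0 dotBr dotZr hk divfK ?gt_eqF// subrr mulr0.
split => //; apply: h_tau0; rewrite tauS//; apply/max_idPl.
move/existsNP: naz => [k /negP]; rewrite -leNgt => ak.
by rewrite (le_trans (tau0_le z k))// mulr_le0_ge0// invr_ge0 ltW.
Qed.

End Push.

(** * Clearing compact parts of a face by successive pushes *)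

Section Clearing.
Context {R : realType}.
Implicit Types (x y z q : pt R) (U V K : set (pt R)).
Variables (u : 'I_4 -> pt R) (tu : tetra u) (E G0 : set (pt R)).
Let N := gaugeT u.
Let S := [set z | N z = 1].
Hypotheses (cE : closed E) (cG : compact G0) (GS : G0 `<=` S).

(** These properties let a composition with earlier maps remain a deformation in the ball of radius
    4 that does not move [E] outside the tetrahedron. *)
Definition admissible (h : pt R -> pt R) := [/\ elip h,
  forall z, 4 < enorm z -> h z = z, forall z, enorm z <= 4 -> enorm (h z) <= 4 &
  forall z, E z -> h z = z].

Lemma admissible_id : admissible id.
Proof. by split => //; exact: elip_id. Qed.

Lemma admissible_comp h g : admissible h -> admissible g -> admissible (h \o g).
Proof.
move=> [h1 h2 h3 h4] [g1 g2 g3 g4]; split => /=.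
- exact: elip_comp.
- by move=> z z4; rewrite g2// h2.
- by move=> z /g3/h3.
- by move=> z Ez; rewrite g4// h4.
Qed.

(* Besides being null, the image must be nowhere dense in U, so that the next
   push finds a centre outside of it. *)
Definition cleared U := exists O h, [/\ open O, U = S `&` O, admissible h,
  h @` G0 `<=` S & H2 (h @` G0 `&` U) = 0%E /\
  forall V, open V -> V `&` U !=set0 -> exists z, [/\ V z, U z & ~ (h @` G0) z]].

Lemma open_open_cone (a : 'I_4 -> pt R) : open (open_cone a).
Proof.
have -> : open_cone a = [set z | maxdot (fun k => - a k) z < 0].
  apply/seteqP; split => z /= h.
    by have [k ->] := maxdot_eq (fun k => - a k) z; rewrite dotNl oppr_lt0.
  by move=> k; rewrite -oppr_lt0 -dotNl (le_lt_trans _ h)// maxdot_ge.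
exact/open_lt_continuous/continuous_maxdot.
Qed.

(** Adding a small multiple of [q] to [z] makes every form positive, and rescaling brings the point
    back to [S]. The bounds on [t] keep the gauge above 1/2, where the truncation is an exact
    rescaling, and the result in [V]. *)
Lemma cone_bdry_near (a : 'I_4 -> pt R) q z V : S q -> open_cone a q -> S z ->
  (forall k, 0 <= dot (a k) z) -> open V -> V z -> V `&` (S `&` open_cone a) !=set0.
Proof.
move=> q1 aq z1 az oV Vz.
have /open_enormP/(_ z Vz)[r r0 hr] := oV.
have q_le1 : enorm q <= 1 by rewrite -q1 enorm_le_gaugeT.
have Ns : slip N by exact: slip_maxdot.
have [L L0 hL] := Ns.
have h2 : 0 < 2^-1 :> R by rewrite invr_gt0.
have [M M0 hM] := elip_rcap Ns h2 ler01 (gauge_norm1 tu).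
pose t := Num.min (2 * (L + 1))^-1 (r / (2 * (M + 1))).
have L1 : 0 < L + 1 by rewrite ltr_wpDl.
have M1 : 0 < M + 1 by rewrite ltr_wpDl.
have t0 : 0 < t by rewrite lt_min invr_gt0 mulr_gt0//= divr_gt0// mulr_gt0.
have tL : L * t <= 2^-1.
  apply: (@le_trans _ _ ((L + 1) * (2 * (L + 1))^-1)).
    by apply: ler_pM => //; [exact: ltW|rewrite lerDl|rewrite ge_min lexx].
  by rewrite le_eqVlt; apply/orP; left; apply/eqP; field; rewrite gt_eqF.
have tM : M * t < r.
  apply: (@le_lt_trans _ _ ((M + 1) * (r / (2 * (M + 1))))).
    by apply: ler_pM => //; [exact: ltW|rewrite lerDl|rewrite ge_min lexx orbT].
  rewrite [ltLHS](_ : _ = r / 2); first by lra.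
  by field; rewrite gt_eqF.
pose w := z + t *: q.
have wz : enorm (w - z) <= t.
  by rewrite /w addrC addKr enormZ gtr0_norm// ler_piMr// ltW.
have Nw : 2^-1 <= N w.
  have := hL w z; rewrite -/(gaugeT u) -/N z1 ler_norml => /andP[h _].
  have : L * enorm (w - z) <= L * t by rewrite ler_wpM2l.
  by lra.
have Nw0 : 0 < N w by apply: lt_le_trans Nw.
exists (rcap N 2^-1 w); split.
  apply: hr; have {1}-> : z = rcap N 2^-1 z.
    by rewrite /rcap z1 (max_idPl _) ?invr1 ?scale1r// invf_le1// ler1n.
  rewrite (le_lt_trans (hM _ _))// (le_lt_trans _ tM)// ler_wpM2l//.
rewrite /rcap (max_idPl Nw); split.
  by rewrite /S/= /N /gaugeT maxdotZ ?invr_ge0 ?(ltW Nw0)// mulVf// gt_eqF.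
move=> k; rewrite dotZr mulr_gt0 ?invr_gt0// /w dotDr dotZr.
by rewrite ltr_wpDl ?az// mulr_gt0.
Qed.

(** As the image is nowhere dense in [U], some point of [U] in the cone is missed and can serve as
    centre; after one push from it no image point is left in the open cone. *)
Lemma cleared_cone U (a : 'I_4 -> pt R) (s : R) : cleared U -> 0 < s <= 1 ->
  (forall z, open_cone a z -> `|N z - 1| < s -> ~ E z) ->
  open_cone a `&` U !=set0 -> cleared (U `|` (S `&` open_cone a)).
Proof.
move=> [W [h [oO UE adm hS [nullU denseU]]]] s01 aE coneU.
have [q [aq Uq nq]] := denseU _ (@open_open_cone a) coneU.
have Sq : S q by move: Uq; rewrite UE => -[].
have [h_lip _ _ _] := adm.
have chG : compact (h @` G0).
  by apply: continuous_compact => //; apply/continuous_subspaceT/elip_continuous.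
have [h' [h'1 h'2 h'3 h'4 h'5]] := push tu s01 Sq aq chG hS nq aE.
have imE : (h' \o h) @` G0 = h' @` (h @` G0) by rewrite image_comp.
exists (W `|` open_cone a), (h' \o h); rewrite imE; split.
- by apply: openU => //; exact: open_open_cone.
- by rewrite UE setIUr.
- exact: admissible_comp.
- by move=> _ [w hw <-]; exact: (h'5 w hw).1.
split.
  have a0 k : a k <> 0 by move=> ak0; have := aq k; rewrite ak0 dot0l ltxx.
  pose Z k := S `&` [set z | dot (a k) z = 0].
  have Z0 k : H2 (Z k) = 0%E by exact: H2_bdry_cap_plane.
  apply: (@H2_null_subset _ _ ((h @` G0 `&` U) `|` (Z 0 `|` Z 1 `|` Z 2 `|` Z 3))).
    move=> _ [[w hw <-] Uw]; have [Sw] := h'5 w hw.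
    move=> [[ew nw]|[_ [k hk]]].
      by left; rewrite ew in Uw *; split => //; case: Uw => // -[].
    right; have Zk : Z k (h' w) by [].
    have := @mem_four 0 1 2 3 isT k; rewrite !inE => /or4P[] /eqP e; rewrite e in Zk.
    - by left; left; left.
    - by left; left; right.
    - by left; right.
    - by right.
  by do !apply: H2_nullU.
(* If [V] meets the cone on [S], the common points are now missed. Otherwise a point of [V] and [U]
   missed before stays missed: a point moved onto it would put it in the closed cone, and by
   [cone_bdry_near] [V] would meet the open one. *)
move=> V oV VU; have [[z [Vz [Sz az]]]|VD] := pselect (V `&` (S `&` open_cone a) !=set0).
  exists z; split; [by []|by right|move=> [w hw wz]].
  have [_ [[ew nw]|[_ [k hk]]]] := h'5 w hw; first by apply: nw; rewrite -ew wz.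
  by have := az k; rewrite -wz hk ltxx.
have [|z [Vz Uz nz]] := denseU V oV.
  by case: VU => z [Vz [Uz|Dz]]; [exists z|case: VD; exists z].
exists z; split; [by []|by left|move=> [w hw wz]].
have [Sw [[ew nw]|[ak _]]] := h'5 w hw; first by apply: nz; rewrite -wz ew.
apply: VD; rewrite wz in Sw ak; exact: (cone_bdry_near Sq aq Sw ak oV Vz).
Qed.

Lemma off_E_cone q : S q -> ~ E q -> exists a (s : R), [/\ open_cone a q, 0 < s <= 1 &
  forall z, open_cone a z -> `|N z - 1| < s -> ~ E z].
Proof.
move=> Sq nEq; have [r r0 hr] := closed_far cE nEq.
have [a [s [aq s01 h]]] := thin_cone tu Sq r0; exists a, s; split => // z az zs Ez.
by have := h z az zs; rewrite ltNge hr.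
Qed.

Variable Omega : set (pt R).
Hypotheses (Omega_sub : Omega `<=` S `\` E) (Omega_conn : connected Omega).

(** The points of [Omega] lying in a cleared extension of [U] form a nonempty set. It is relatively
    open because cleared sets are, and relatively closed because a thin cone around a limit point
    contains such a point, from which the cone can be cleared. *)
Lemma cleared_point U q : cleared U -> U `&` Omega !=set0 -> Omega q ->
  exists U', [/\ cleared U', U `<=` U' & U' q].
Proof.
move=> cU [p [Up Op]] Oq.
pose good x := exists U', [/\ cleared U', U `<=` U' & U' x].
pose B := [set x | Omega x /\ good x].
suff : B = Omega by move=> BO; move: Oq; rewrite -BO => -[].
apply: Omega_conn; first by exists p; split => //; exists U; split => // z.
- exists (\bigcup_(O in [set O | open O /\ forall x, S x -> O x -> good x]) O).
    by apply: bigcup_open => O [].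
  apply/seteqP; split => [x [Ox [U' [cU' UU' U'x]]]|x [Ox [W [_ h] Ox']]].
    split => //; have [W [h [oO UE _ _ _]]] := cU'; exists W.
      by split => // z Sz Oz; exists U'; split => //; rewrite UE.
    by move: U'x; rewrite UE => -[].
  by split => //; apply: h => //; case: (Omega_sub Ox).
- exists (closure B); first exact: closed_closure.
  apply/seteqP; split => [x Bx|x [Ox cBx]]; first by split; [case: Bx|exact: subset_closure].
  split => //; have [Sx nEx] := Omega_sub Ox.
  have [a [s [ax s01 aE]]] := off_E_cone Sx nEx.
  have : nbhs x (open_cone a).
    by move: ax; have := @open_open_cone a; rewrite openE => h /h.
  move=> /cBx[b [[Ob [U' [cU' UU' U'b]]] ab]].
  exists (U' `|` (S `&` open_cone a)); split.
  + by apply: cleared_cone cU' s01 aE _; exists b.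
  + by move=> z /UU' ?; left.
  + by right.
Qed.

(** Finitely many thin cones cover [K]. Their base points are reached one after the other by
    [cleared_point], and [cleared_cone] then adds each whole cone. *)
Lemma cleared_compact U K : cleared U -> U `&` Omega !=set0 -> compact K ->
  K `<=` Omega -> exists U', [/\ cleared U', U `<=` U' & K `<=` U'].
Proof.
move=> cU UO cK KO.
have /choice[a ha] : forall q, exists a : 'I_4 -> pt R, Omega q ->
    open_cone a q /\ exists2 s : R, 0 < s <= 1 &
    forall z, open_cone a z -> `|N z - 1| < s -> ~ E z.
  move=> q; have [Oq|nOq] := pselect (Omega q); last by exists u.
  have [Sq nEq] := Omega_sub Oq; have [a [s [? ? ?]]] := off_E_cone Sq nEq.
  by exists a => _; split => //; exists s.
move: cK; rewrite compact_cover => /(_ _ K (fun q => open_cone (a q))).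
case=> [q _|q Kq|D DK cov]; first exact: open_open_cone.
  by exists q => //; exact: (ha _ (KO _ Kq)).1.
have [U' [cU' UU' hU']] : exists U', [/\ cleared U', U `<=` U' &
    forall q, q \in finmap.enum_fset D -> S `&` open_cone (a q) `<=` U'].
  have : forall q, q \in finmap.enum_fset D -> Omega q.
    by move=> q qD; apply: KO; apply: set_mem; exact: DK.
  elim: (finmap.enum_fset D) => [|q l IH] hl; first by exists U; split => // z.
  have [q' ql|U' [cU' UU' hU']] := IH; first by apply: hl; rewrite inE ql orbT.
  have Oq : Omega q by apply: hl; rewrite inE eqxx.
  have [|U2 [cU2 U2U U2q]] := cleared_point cU' _ Oq.
    by case: UO => p [Up Op]; exists p; split => //; exact: UU'.
  have [aq [s s01 aE]] := ha _ Oq.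
  exists (U2 `|` (S `&` open_cone (a q))); split.
  - by apply: cleared_cone cU2 s01 aE _; exists q.
  - by move=> z /UU'/U2U; left.
  - move=> q'; rewrite inE => /orP[/eqP ->|/hU' h]; first by move=> z; right.
    by move=> z /h/U2U; left.
exists U'; split => // z Kz; have [q qD aqz] := cov _ Kz.
by apply: (hU' q) => //; split => //; case: (Omega_sub (KO _ Kz)).
Qed.

End Clearing.

(** * Competitors *)

Section Additivity.
Context {R : realType}.
Implicit Types (A B K : set (pt R)).

Lemma H2_disjointU A B : (@H2o R).-caratheodory A -> A `&` B = set0 ->
  H2 (A `|` B) = (H2 A + H2 B)%E.
Proof.
move=> mA AB; have := mA (A `|` B); rewrite /H2o/= => ->; congr (_ + _)%E; congr H2.
  by apply/seteqP; split => x; [case|move=> Ax; split => //; left].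
apply/seteqP; split => x; first by move=> [[//|]].
by move=> Bx; split; [right|move=> Ax; have : (A `&` B) x by []; rewrite AB].
Qed.

(** Continuity from above of the measure induced by [H2] on its Caratheodory sets, applied to the
    differences, which decrease to the empty set. *)
Lemma H2_inner_approx A (K : nat -> set (pt R)) (e : R) : (H2 A < +oo)%E ->
  (forall n, closed (K n)) -> (forall m n, (m <= n)%N -> K m `<=` K n) ->
  (@H2o R).-caratheodory A -> A `<=` \bigcup_n K n -> 0 < e ->
  exists n, (H2 (A `\` K n) <= e%:E)%E.
Proof.
move=> Afin cK Kmono mA AK e0.
pose mu : {measure set (caratheodory_type (@H2o R)) -> \bar R} := @H2o R.
pose D n : set (caratheodory_type (@H2o R)) := A `\` K n.
have mD n : measurable (D n).
  by apply: measurableD => //; exact: closed_caratheodory.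
have D0 : \bigcap_n D n = set0.
  apply/seteqP; split => // x Dx; have [n _ Kx] := AK _ (Dx 0%N I).1.
  exact: (Dx n I).2.
have := @nonincreasing_cvg_mu _ _ _ mu D.
rewrite D0 measure0 => /(_ _ mD (@measurable0 _ _)) h.
have {}h : mu \o D @ \oo --> 0%E.
  apply: h; first by rewrite (le_lt_trans _ Afin)//; apply: le_H2; exact: subDsetl.
  move=> m n mn; apply/subsetPset => x [Ax nK]; split => // /(Kmono _ _ mn).
  exact: nK.
have /fine_cvgP[_ /cvgrPdist_lt/(_ e e0)[n _ hn]] := h.
exists n; have := hn n (leqnn n); rewrite /= sub0r normrN => hne.
have fin : H2 (A `\` K n) \is a fin_num.
  rewrite ge0_fin_numE ?H2_ge0// (le_lt_trans _ Afin)// le_H2//; exact: subDsetl.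
by rewrite -(fineK fin) lee_fin (le_trans (ler_norm _))// ltW.
Qed.

End Additivity.

(** * Radial projection from an interior point of the tetrahedron *)

Section RadialProjection.
Context {R : realType}.
Implicit Types (x y z m : pt R).
Variables (u : 'I_4 -> pt R) (tu : tetra u) (m : pt R) (rho : R).
Let N := gaugeT u.
Hypotheses (m1 : N m < 1) (rho0 : 0 < rho) (rho1 : rho <= 1).

(** Gauge of the tetrahedron seen from [m]: 1/3 + dot (u k) m is the distance from [m] to the plane
    of the face opposite to [u k], positive since N m < 1. *)
Definition gauge_at z := maxdot (fun k => - (3^-1 + dot (u k) m)^-1 *: u k) z.

(** Inside the tetrahedron, off the core of gauge below [rho] around [m], this is the projection
    from [m] onto the boundary; outside, the two truncations agree and cancel. *)
Definition radial z := z + (rcap gauge_at rho (z - m) - rcap gauge_at 1 (z - m)).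

Let d_gt0 k : 0 < 3^-1 + dot (u k) m.
Proof. by have := m1; have := gaugeT_ge u m k; rewrite -/N; lra. Qed.

Let form k := - (3^-1 + dot (u k) m)^-1 *: u k.

Let dot_form k w : (3^-1 + dot (u k) m) * dot (form k) w = - dot (u k) w.
Proof. by rewrite dotZl mulrA mulrN mulfV ?mulN1r// gt_eqF. Qed.

Lemma gauge_at_le1 z : gauge_at (z - m) <= 1 <-> N z <= 1.
Proof.
rewrite /gauge_at -maxdot_leP -gaugeT_leP.
split => h k; have := h k; have := dot_form k (z - m); have := d_gt0 k;
  rewrite -/(form k) (dotBr (u k)); nra.
Qed.

Lemma gauge_at_eq1 z : gauge_at (z - m) = 1 -> N z = 1.
Proof.
move=> z1; apply/eqP; rewrite eq_le; apply/andP; split.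
  by apply/gauge_at_le1; rewrite z1.
have [k hk] := maxdot_eq form (z - m).
have := dot_form k (z - m); rewrite -hk -/(gauge_at _) z1 (dotBr (u k)).
by have := gaugeT_ge u z k; rewrite -/N; lra.
Qed.

(** The factor 4 is three times 1/3 + 1, since dot (u k) m is at most 1. *)
Lemma enorm_le_gauge_at w : enorm w <= 4 * gauge_at w.
Proof.
have ge k : - dot (u k) w <= (3^-1 + dot (u k) m) * gauge_at w.
  by rewrite -dot_form ler_wpM2l ?(ltW (d_gt0 k))//; exact: maxdot_ge.
have g0 : 0 <= gauge_at w.
  rewrite leNgt; apply/negP => gneg.
  have pos k : 0 < dot (u k) w by have := ge k; have := d_gt0 k; nra.
  have := dot_sum0 tu w; rewrite (bigD1 0)//= => /eqP; rewrite gt_eqF//.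
  by rewrite ltr_pwDl// sumr_ge0// => k _; exact/ltW.
have m_le1 : enorm m <= 1.
  by rewrite (le_trans (enorm_le_gaugeT tu m))// ltW.
apply: le_trans (enorm_le_gaugeT tu w) _; apply/gaugeT_leP => k.
have := ge k.
have : dot (u k) m <= 1.
  by rewrite (le_trans (cauchy_schwarz _ _))// (tetra_norm tu) mul1r.
nra.
Qed.

Lemma gauge_at_gt0 w : w <> 0 -> 0 < gauge_at w.
Proof. by move=> /enorm_gt0 w0; have := enorm_le_gauge_at w; lra. Qed.

Lemma elip_radial : elip radial.
Proof.
have sg : slip gauge_at by exact: slip_maxdot.
have el c : 0 < c -> elip (fun z => rcap gauge_at c (z - m)).
  move=> c0; apply: (@elip_comp _ (rcap gauge_at c)).
    by apply: (elip_rcap sg c0 (_ : 0 <= 4)) => // w; exact: enorm_le_gauge_at.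
  by exists 1 => // x y; rewrite opprD opprK addrACA addNr addr0 mul1r.
by apply: (@elipD _ id _ (@elip_id R)); apply: elipD; [exact: el|apply/elipN/el].
Qed.

Lemma radial_out z : ~ N z <= 1 -> radial z = z.
Proof.
move/gauge_at_le1/negP; rewrite -ltNge => z1.
rewrite /radial /rcap !(max_idPl _) ?subrr ?addr0// ?ltW//.
exact: le_lt_trans z1.
Qed.

Lemma radial_in z : N z <= 1 -> radial z = m + rcap gauge_at rho (z - m).
Proof.
move/gauge_at_le1 => z1.
rewrite /radial {2}/rcap (max_idPr z1) invr1 scale1r.
by move: (rcap _ _ _) => w; apply/rowP => c; rewrite !mxE; ring.
Qed.

Lemma radial_in_le1 z : N z <= 1 -> N (radial z) <= 1.
Proof.
move=> z1; apply/gauge_at_le1; rewrite radial_in// addrC addKr /rcap.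
set M := Num.max _ _; have M0 : 0 < M by rewrite lt_max rho0 orbT.
rewrite /gauge_at maxdotZ ?invr_ge0 ?(ltW M0)// -/(gauge_at _).
by rewrite ler_pdivrMl// mulr1 le_max lexx.
Qed.

Lemma radialE z : N z <= 1 -> rho <= gauge_at (z - m) ->
  radial z = m + (gauge_at (z - m))^-1 *: (z - m).
Proof. by move=> z1 rz; rewrite radial_in// /rcap (max_idPl rz). Qed.

Lemma radial_bdry z : N z <= 1 -> rho <= gauge_at (z - m) -> N (radial z) = 1.
Proof.
move=> z1 rz; have g0 : 0 < gauge_at (z - m) by exact: lt_le_trans rz.
apply: gauge_at_eq1; rewrite radialE// addrC addKr.
by rewrite /gauge_at maxdotZ ?invr_ge0 ?(ltW g0)// mulVf// gt_eqF.
Qed.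

End RadialProjection.

Section Final.
Context {R : realType}.
Implicit Types (x y z m : pt R).

(** For [m] distinct from [i] and [j], the arc between the nodes [j] and [m] borders [Omega i]. Its
    point of parameter 1/2 is not a node, so it lies on no other arc, in particular on none that
    borders [Omega j]. *)
Lemma trace_faces_inj (eta : R) T (y : 'I_4 -> pt R) E b w Omega i j :
  trace_graph eta T y E b w -> trace_faces T E w Omega -> i != j -> Omega i <> Omega j.
Proof.
move=> tg [_ _ Oc] ij Oij.
have [m] := @exists_notin [:: i; j] isT; rewrite !inE negb_or => /andP[mi mj].
have [k [l [kl ki li jkl]]] : exists k l : 'I_4,
    [/\ (k < l)%N, k != i, l != i & j \in [:: k; l]].
  case: (ltngtP j m) => [jm|mj'|jm].
  - by exists j, m; split; rewrite ?inE ?eqxx// eq_sym.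
  - by exists m, j; split; rewrite ?inE ?eqxx ?orbT// eq_sym.
  - by move: mj; rewrite (ord_inj jm) eqxx.
have half01 : 0 <= (2^-1 : R) <= 1 by rewrite invr_ge0 ler0n/= invf_le1// ler1n.
have : (closure (Omega i) `\` Omega i) (w k l 2^-1).
  by rewrite Oc; exists k, l; split => //; exists 2^-1.
rewrite Oij Oc => -[c [d [cd cj dj wcd]]].
have klcd : (k, l) != (c, d).
  apply/eqP => -[kc ld]; move: jkl; rewrite kc ld !inE.
  by rewrite !(eq_sym j) (negbTE cj) (negbTE dj).
have : (Defs.arc (w k l) `&` Defs.arc (w c d)) (w k l 2^-1) by split => //; exists 2^-1.
rewrite (trace_arc_meet tg kl cd klcd) => -[n [nkl _] bn].
have [w0 w1] := trace_arc_ends tg kl.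
move: nkl bn; rewrite !inE => /orP[] /eqP -> bn.
  have := trace_arc_simple tg kl (_ : 0 <= 0 <= 1) half01.
  by rewrite w0 lexx ler01 => /(_ isT bn) /eqP; rewrite eq_sym invr_eq0 pnatr_eq0.
have := trace_arc_simple tg kl (_ : 0 <= 1 <= 1) half01.
rewrite w1 lexx ler01 => /(_ isT bn) h.
have : (2^-1 : R) < 1 by rewrite invf_lt1// ltr1n.
by rewrite -h ltxx.
Qed.

Lemma connected_segment (p q : pt R) : connected (segment p q).
Proof.
have -> : segment p q = (fun t : R => (1 - t) *: p + t *: q) @` `[0, 1].
  by apply/seteqP; split => _ [t t01 <-]; exists t => //; move: t01; rewrite /= in_itv.
apply: connected_continuous_connected; first exact: segment_connected.
apply: continuous_subspaceT => t.
apply: cvgD; apply: cvgZr_tmp; last exact: cvg_id.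
by apply: cvgB; [exact: cvg_cst|exact: cvg_id].
Qed.

(** A deformation is given as the identity only off the tetrahedron; the points (1 + t) z lie there
    and tend to z, which settles the boundary by continuity. *)
Lemma deformation_bdry_id u (f : pt R -> pt R) z : elip f ->
  (forall x, ~ gaugeT u x <= 1 -> f x = x) -> gaugeT u z = 1 -> f z = z.
Proof.
move=> [L L0 hL] fid z1; apply/eqP; rewrite -subr_eq0; apply/eqP/enorm_eq0.
apply/eqP; rewrite eq_le enorm_ge0 andbT; apply/ler_addgt0Pr => e e0; rewrite add0r.
pose t := e / ((L + 1) * (enorm z + 1)).
have t0 : 0 < t by rewrite divr_gt0 ?mulr_gt0 ?ltr_wpDl ?enorm_ge0.
pose x := (1 + t) *: z.
have xz : enorm (x - z) = t * enorm z.
  by rewrite /x scalerDl scale1r addrC addKr enormZ gtr0_norm.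
have fx : f x = x.
  apply: fid; rewrite /gaugeT maxdotZ ?addr_ge0 ?(ltW t0)// -/(gaugeT u z) z1 mulr1.
  by apply/negP; rewrite -ltNge ltrDl.
apply: (@le_trans _ _ ((L + 1) * (t * enorm z))).
  rewrite -xz (le_trans (enormBD (f x) _ _))// mulrDl mul1r lerD//.
    by rewrite enormB.
  by rewrite fx.
rewrite mulrA mulrC /t.
have -> : enorm z * ((L + 1) * (e / ((L + 1) * (enorm z + 1)))) = e * (enorm z / (enorm z + 1)).
  by field; rewrite !gt_eqF// ltr_wpDl// enorm_ge0.
rewrite ler_piMr ?(ltW e0)// ler_pdivrMr ?ltr_wpDl ?enorm_ge0// mul1r lerDl//.
Qed.

(** The image is the union of a compact set and of a closed part of [E] that is not moved. *)
Lemma closed_image (E : set (pt R)) (f : pt R -> pt R) (r : R) : closed E -> elip f ->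
  (forall z, r <= enorm z -> f z = z) -> closed (f @` E).
Proof.
move=> cE lf fid.
have en : continuous (@enorm R).
  apply: slip_continuous; exists 1 => // x y; rewrite mul1r ler_norml.
  have := enormBD x y 0; have := enormBD y x 0; rewrite !subr0 (enormB y x) => ? ?.
  by apply/andP; split; lra.
have c1 : closed [set z : pt R | enorm z <= r] by exact: closed_le_continuous.
have c2 : closed [set z : pt R | r <= enorm z].
  rewrite (_ : [set z | _] = @enorm R @^-1` [set t | r <= t])//.
  by apply: closed_comp => [x _|]; [exact: en|exact: closed_ge].
have -> : f @` E = f @` (E `&` [set z | enorm z <= r]) `|` (E `&` [set z | r <= enorm z]).
  apply/seteqP; split => [_ [z Ez <-]|x [[z [Ez _] <-]|[Ez xr]]].
  - have [zr|zr] := leP r (enorm z); first by right; rewrite fid.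
    by left; exists z => //; split => //; exact: ltW.
  - by exists z.
  - by exists x => //; exact: fid.
apply: closedU; last exact: closedI.
apply: compact_closed; first exact: norm_hausdorff.
apply: continuous_compact; first exact/continuous_subspaceT/elip_continuous.
by apply: (@bounded_closed_compact_enorm _ _ r) => [|z []//]; exact: closedI.
Qed.

Lemma compact_ball_gauge (u : 'I_4 -> pt R) : tetra u ->
  [set z | gaugeT u z <= 1] `<=` compact_ball 0 1.
Proof.
by move=> tu z; rewrite /compact_ball/= subr0; apply: le_trans; exact: enorm_le_gaugeT.
Qed.

End Final.

Section Pinch.
Context {R : realType}.
Implicit Types (x y z m p q : pt R).
Variables (u : 'I_4 -> pt R) (tu : tetra u).
Let N := gaugeT u.
Let C := [set z | N z <= 1].
Let S := [set z | N z = 1].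

Lemma segment_hits_interior (E : set (pt R)) (f : pt R -> pt R) x x' p q :
  elip f -> (forall z, ~ C z -> f z = z) ->
  connected_component (S `\` E) x <> connected_component (S `\` E) x' ->
  connected_component (S `\` E) x p -> connected_component (S `\` E) x' q ->
  segment p q `<=` C `\` f @` E -> exists2 m, segment p q m & N m < 1.
Proof.
move=> lf fid xx' xp x'q pqC; apply: contrapT => no; apply: xx'.
have pS : segment p q `<=` S `\` E.
  move=> z pqz; have [z1 nfz] := pqC _ pqz.
  have Nz : N z = 1.
    apply/eqP; rewrite eq_le z1/= leNgt; apply/negP => z1'; apply: no.
    by exists z.
  split => // Ez; apply: nfz; exists z => //.
  exact: deformation_bdry_id lf fid Nz.
have pp : segment p q p.
  by exists 0; [rewrite /= lexx ler01|rewrite subr0 scale1r scale0r addr0].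
have qq : segment p q q.
  by exists 1; [rewrite /= lexx ler01|rewrite subrr scale1r scale0r add0r].
have pq := connected_component_max pp pS (@connected_segment _ p q).
rewrite (same_connected_component xp) (same_connected_component (pq _ qq)).
by rewrite (same_connected_component x'q).
Qed.

Lemma pinch (E : set (pt R)) (f : pt R -> pt R) m p q : closed E ->
  elip f -> (forall z, ~ C z -> f z = z) -> f @` C `<=` C ->
  segment p q `<=` C `\` f @` E -> segment p q m -> N m < 1 -> S p -> S q ->
  exists P : pt R -> pt R, [/\ elip P, forall z, ~ C z -> P z = z, P @` C `<=` C,
    (P \o f) @` (E `&` C) `<=` S &
    ~ ((P \o f) @` (E `&` C)) p /\ ~ ((P \o f) @` (E `&` C)) q].
Proof.
move=> cE lf fid fC pqC [t /= /andP[t0 t1] em] m1 Sp Sq.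
have cK : compact (f @` (E `&` C)).
  apply: continuous_compact; first exact/continuous_subspaceT/elip_continuous.
  rewrite setIC; apply: compact_closedI => //; exact: compact_solid.
have mf z : (E `&` C) z -> f z <> m.
  move=> [Ez Cz] fz; have [|_ h] := pqC m; first by exists t; rewrite /= ?t0.
  by apply: h; exists z.
have gc : continuous (fun z => gauge_at u m (z - m)).
  apply/slip_continuous/(@slip_comp _ (gauge_at u m) (fun z => z - m)).
    exact: slip_maxdot.
  by exists 1 => // x y; rewrite opprD opprK addrACA addNr addr0 mul1r.
have [|r r0 hr] := compact_pos_lower_bound cK gc.
  move=> _ [z hz <-]; apply: (gauge_at_gt0 tu m1) => /eqP.
  by rewrite subr_eq0 => /eqP; exact: mf.
(* On the compact image of [E] in [C] the gauge is at least [rho], so every point of it is projected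
   exactly onto the boundary. *)
pose rho := Num.min r 1.
have rho0 : 0 < rho by rewrite lt_min r0 ltr01.
have rho1 : rho <= 1 by rewrite ge_min lexx orbT.
have rhoK z : (E `&` C) z -> rho <= gauge_at u m (f z - m).
  move=> hz; apply: (@le_trans _ _ r); first by rewrite ge_min lexx.
  by apply: hr; exists z.
have Cf z : C z -> C (f z) by move=> Cz; apply: fC; exists z.
exists (radial u m rho).
(* A point projected onto [x] lies on the segment from [m] to [x], here a part of [p, q], which the
   image of [E] avoids. *)
have avoid z x : (E `&` C) z -> segment m x `<=` segment p q ->
    radial u m rho (f z) <> x.
  move=> hz mx e; have [Ez Cz] := hz.
  have fzC := Cf _ Cz; have g1 : gauge_at u m (f z - m) <= 1 by exact/(gauge_at_le1 m1).
  have rg := rhoK _ hz; have g0 : 0 < gauge_at u m (f z - m) by exact: lt_le_trans rg.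
  have [|_ h] := pqC (f z); last by apply: h; exists z.
  apply: mx; exists (gauge_at u m (f z - m)); first by rewrite /= ltW.
  rewrite -e (radialE m1 fzC rg) scalerDr scalerA mulfV ?gt_eqF// scale1r.
  by rewrite addrA -scalerDl subrK scale1r addrC subrK.
have segl : segment m p `<=` segment p q.
  move=> _ [s /= /andP[s0 s1] <-]; exists ((1 - s) * t).
    rewrite /= mulr_ge0 ?subr_ge0//=.
    by rewrite mulr_ile1 ?subr_ge0// lerBlDr lerDl.
  by rewrite -em; apply/rowP => c; rewrite !mxE; ring.
have segr : segment m q `<=` segment p q.
  move=> _ [s /= /andP[s0 s1] <-]; exists ((1 - s) * t + s).
    rewrite /= addr_ge0 ?mulr_ge0 ?subr_ge0//=.
    by nra.
  by rewrite -em; apply/rowP => c; rewrite !mxE; ring.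
split.
- exact: elip_radial.
- move=> z; exact: radial_out.
- move=> _ [z Cz <-]; exact: radial_in_le1.
- move=> _ [z hz <-]; apply: radial_bdry => //; last exact: rhoK.
  by apply: Cf; case: hz.
by split=> -[z hz]; exact: avoid.
Qed.

End Pinch.

Section Competitor.
Context {R : realType}.
Implicit Types (x y z m p q : pt R) (E A B K : set (pt R)).
Variables (u : 'I_4 -> pt R) (tu : tetra u).
Let N := gaugeT u.
Let C := [set z | N z <= 1].
Let S := [set z | N z = 1].

Lemma competitor E f p q A B KA KB : almgren_minimal E -> deformation C f ->
  segment p q `<=` C `\` f @` E -> (exists2 m, segment p q m & N m < 1) ->
  A `<=` S `\` E -> B `<=` S `\` E -> connected A -> connected B -> A p -> B q ->
  compact KA -> compact KB -> KA `<=` A -> KB `<=` B ->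
  (H2 (E `&` C) <= H2 (E `&` S) + H2 (S `\` E `\` (KA `|` KB)))%E.
Proof.
move=> [cE _ minE] [/elipP lf fid fC] pqC [m pqm m1] AS BS cA cB Ap Bq cKA cKB KAA KBB.
have [Sp _] := AS _ Ap; have [Sq _] := BS _ Bq.
have [P [lP Pid PC PS [nPp nPq]]] := pinch tu cE lf fid fC pqC pqm m1 Sp Sq.
set G := (P \o f) @` (E `&` C) in PS nPp nPq.
have cG : compact G.
  apply: continuous_compact; first exact/continuous_subspaceT/elip_continuous/elip_comp.
  rewrite setIC; apply: compact_closedI => //; exact: compact_solid.
have clG : closed G by apply: compact_closed cG; exact: norm_hausdorff.
(* The clearing starts from the part of the boundary missed by [G], which contains both [p] and
   [q]. *)
have cl0 : cleared u E G (S `\` G).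
  exists (~` G), id; rewrite image_id; split => //.
  - exact: closed_openC.
  - exact: admissible_id.
  split; first by rewrite setDE setICA setICr setI0 H2_set0.
  by move=> V _ [z [Vz [Sz nGz]]]; exists z.
have [U1 [cl1 U01 KAU]] : exists U', [/\ cleared u E G U', S `\` G `<=` U' & KA `<=` U'].
  by apply: cleared_compact cl0 _ cKA KAA => //; exists p.
(* Cleared sets only grow, so the second clearing keeps [KA] cleared and [q] is still available as
   its starting point. *)
have [|U2 [cl2 U12 KBU]] := cleared_compact tu cE cG BS cB cl1 _ cKB KBB.
  by exists q; split => //; exact: U01.
have [_ [h [_ _ [lh h_far h_ball hE] hS [hU _]]]] := cl2.
pose phi := h \o (P \o f).
have outC z : 1 < enorm z -> ~ C z.
  move=> z1 Cz; have := enorm_le_gaugeT tu z; rewrite leNgt => /negP; apply.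
  exact: le_lt_trans Cz z1.
have inC z : C z -> enorm z <= 4.
  by move=> Cz; rewrite leNgt; apply/negP => z4; apply: (outC z) => //; lra.
have phi_far z : 4 < enorm z -> phi z = z.
  move=> z4; have nCz : ~ C z by apply: outC; lra.
  by rewrite /phi /= fid// Pid// h_far.
have phi_lip : elip phi by do 2!apply: elip_comp => //.
have PfC z : C z -> C (P (f z)).
  by move=> Cz; apply: PC; exists (f z) => //; apply: fC; exists z.
have phi_out z : E z -> ~ C z -> phi z = z.
  by move=> Ez nCz; rewrite /phi/= fid// Pid// hE.
have phi_in z : E z -> C z -> (h @` G) (phi z).
  by move=> Ez Cz; exists (P (f z)) => //; exists z.
have minphi : (H2 (E `\` phi @` E) <= H2 (phi @` E `\` E))%E.
  apply: (minE 0 4) => //.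
    split; [exact/elipP|move=> z|move=> _ [z + <-]]; rewrite /compact_ball/= !subr0.
      by move=> /negP; rewrite -ltNge; exact: phi_far.
    move=> z4; have [Cz|nCz] := pselect (C z); first exact/h_ball/inC/PfC.
    by rewrite /phi/= fid// Pid// h_ball.
  (* The radius 5 exceeds 4 because [phi] is known to be the identity only strictly beyond 4. *)
  by apply: (@closed_image _ _ _ 5) => // z z5; apply: phi_far; lra.
(* Minimality compares the two differences: the image of [E] inside [C] lies in [S], and nothing has
   moved outside, so all of [E] in the open tetrahedron is lost. *)
have sub1 : E `&` C `<=` (E `&` S) `|` (E `\` phi @` E).
  move=> z [Ez Cz]; have [Sz|nSz] := pselect (S z); [by left|right].
  split => // -[z' Ez' zz']; have [Cz'|nCz'] := pselect (C z').
    by apply: nSz; rewrite -zz'; apply: hS; exact: phi_in.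
  by apply: (nCz'); rewrite -(phi_out _ Ez' nCz') zz'.
have sub2 : phi @` E `\` E `<=` (S `\` E `\` (KA `|` KB)) `|` (h @` G `&` U2).
  move=> _ [[z Ez <-] nE].
  have Cz : C z by apply: contrapT => nCz; apply: nE; rewrite phi_out.
  have hz := phi_in _ Ez Cz.
  have [[/KAU/U12|/KBU]|nK] := pselect ((KA `|` KB) (phi z)); [by right|by right|left].
  by split => //; split => //; exact: hS.
apply: le_trans (le_H2 sub1) _; apply: le_trans (H2U _ _) _; apply: leeD2l.
apply: le_trans minphi _; apply: le_trans (le_H2 sub2) _.
by apply: le_trans (H2U _ _) _; rewrite [X in (_ + X)%E]hU adde0.
Qed.

End Competitor.

(** * Measurability and inner approximation of the faces *)

Section Faces.
Context {R : realType}.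
Implicit Types (x y z p q : pt R) (E : set (pt R)).
Variables (u : 'I_4 -> pt R) (tu : tetra u) (E : set (pt R)) (cE : closed E).
Let C := [set z | gaugeT u z <= 1].
Let S := [set z | gaugeT u z = 1].

Lemma closed_solid_bdry : closed S.
Proof.
have -> : S = bdry [set z | maxdot (fun k => - 3 *: u k) z <= 1] by rewrite bdry_sublevel.
by apply: closedI; [exact: closed_closure|exact/open_closedC/open_interior].
Qed.

Variable Omega : set (pt R).
Hypotheses (OSE : Omega `<=` S `\` E) (cO : closure Omega `\` Omega `<=` E).

(** A difference of two closed sets, which gives the measurability of the face. *)
Lemma faceE : Omega = closure Omega `\` E.
Proof.
apply/seteqP; split => x.
  by move=> Ox; split; [exact: subset_closure|case: (OSE Ox)].
by move=> [cOx nEx]; apply: contrapT => nOx; apply: nEx; exact: cO.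
Qed.

Lemma face_measurable : (@H2o R).-caratheodory Omega.
Proof.
rewrite faceE; apply: caratheodory_measurable_setD; apply: closed_caratheodory => //.
exact: closed_closure.
Qed.

Lemma face_inner_compact (e : R) : (H2 S < +oo)%E -> 0 < e ->
  exists K, [/\ compact K, K `<=` Omega & (H2 (Omega `\` K) <= e%:E)%E].
Proof.
move=> Sfin e0.
(* Keeping a distance 1 / (n + 1) from [E] exhausts the face by closed sets. *)
pose far n := [set z : pt R | forall w, E w -> n.+1%:R^-1 <= enorm (z - w)].
pose K n := closure Omega `&` far n.
have farc n : closed (far n).
  have -> : far n = \bigcap_(w in E) [set z | - enorm (z - w) <= - n.+1%:R^-1].
    by apply/seteqP; split => z h w Ew; have := h w Ew; rewrite /= lerN2.
  apply: closed_bigI => w _; apply: closed_le_continuous; apply: slip_continuous.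
  exists 1 => // x y; rewrite mul1r opprK ler_norml.
  have := enormBD x y w; have := enormBD y x w; rewrite (enormB y x) => ? ?.
  by apply/andP; split; lra.
have cK n : closed (K n) by apply: closedI; [exact: closed_closure|exact: farc].
have clS : closure Omega `<=` S.
  by rewrite ((closure_id S).1 closed_solid_bdry); apply: closureS => x /OSE[].
have KO n : K n `<=` Omega.
  move=> z [cz fz]; rewrite faceE; split => // Ez.
  by have := fz _ Ez; rewrite subrr enorm0 leNgt invr_gt0 ltr0n.
have [||n m mn z [cz fz]||||n hn] := @H2_inner_approx _ Omega K e.
- by rewrite (le_lt_trans _ Sfin)//; apply: le_H2 => x /OSE[].
- exact: cK.
- split => // w /fz; apply: le_trans.
  by rewrite lef_pV2 ?posrE ?ltr0n// ler_nat ltnS.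
- exact: face_measurable.
- move=> z Oz; have [_ nEz] := OSE Oz; have [r r0 hr] := closed_far cE nEz.
  exists (Num.truncn r^-1) => //; split; first exact: subset_closure.
  move=> w /hr; rewrite enormB; apply: le_trans.
  by rewrite invf_ple ?posrE ?ltr0n// ltW// truncnS_gt.
- exact: e0.
exists (K n); split; [|exact: KO|exact: hn].
apply: (@bounded_closed_compact_enorm _ _ 1); first exact: cK.
by move=> z [/clS Sz _]; rewrite -Sz; exact: enorm_le_gaugeT.
Qed.

End Faces.

(** The inequality s <= 2 t means d >= 0. Then es + mk + ml = s - mi - mj < s / 2 + 2 d = t - 2 d <=
    t - d < a, against the upper bound on [a] once [e] is small. *)
Lemma area_contradiction (R : realType) (t s a es mi mj mk ml : \bar R) :
  let d := ((4^-1)%:E * (t - (2^-1)%:E * s))%E in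
  (0 <= t < +oo -> 0 <= s < +oo -> s <= t + t -> 0 <= a < +oo ->
  s = es + (mi + (mj + (mk + ml))) ->
  (forall e : R, (0 < e)%R -> a <= es + (mk + (ml + (e%:E + e%:E)))) ->
  t - d < a -> (4^-1)%:E * s - d < mi -> (4^-1)%:E * s - d < mj -> False)%E.
Proof.
move=> d /andP[t0 ty] /andP[s0 sy] st /andP[a0 ay] se ae.
have sf : s \is a fin_num by rewrite ge0_fin_numE.
have af : a \is a fin_num by rewrite ge0_fin_numE.
have tf : t \is a fin_num by rewrite ge0_fin_numE.
move: (sf); rewrite se !fin_numD => /and5P[esf mif mjf mkf mlf].
move: se ae st; rewrite {}/d; case: t tf {t0 ty} => // t _; case: a af {a0 ay} => // a _.
case: es esf => // es _; case: mi mif => // mi _; case: mj mjf => // mj _.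
case: mk mkf => // mk _; case: ml mlf => // ml _; case: s sf {s0 sy} => // s _ [se] ae.
rewrite -!EFinD lee_fin /= !lte_fin => st h1 h2 h3.
(* A quarter of the gap: the two errors [e] use up only half of it. *)
have e0 : (0 < (a - (es + mk + ml)) / 4)%R by lra.
by have := ae _ e0; rewrite -!EFinD lee_fin; lra.
Qed.

Theorem proposition2p10 (R : realType) :
  exists2 eta0 : R, 0 < eta0 &
  forall eta : R, 0 < eta <= eta0 ->
  forall (T : set (pt R)) (y : 'I_4 -> pt R) (eps1 eps2 : R),
    T_set T ->
    set_bij [set: 'I_4] (Y_points T) y ->
    0 < eps1 -> 0 < eps2 ->
    regularity_constants eta T y eps1 eps2 ->
  forall E : set (pt R),
    reduced E -> almgren_minimal E ->
    (drel 0 2 E T < (Num.min eps1 eps2)%:E)%E ->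
    (forall x, ~ type_T E x) ->
  forall (b : 'I_4 -> pt R) (w : 'I_4 -> 'I_4 -> R -> pt R)
         (Omega : 'I_4 -> set (pt R)),
    trace_graph eta T y E b w ->
    trace_faces T E w Omega ->
  ~ exists f : pt R -> pt R,
      deformation (solid T) f /\
      exists (i j : 'I_4) (p q : pt R),
        [/\ i != j, Omega i p, Omega j q &
            segment p q `<=` solid T `\` f @` E].
Proof.
exists 1 => // eta _ T y eps1 eps2 /T_set_sectors[u tu ->] yY _ _ reg.
move=> E redE minE dE _ b w Omega tg tf [f [deff [i [j [p [q [ij Oip Ojq pqC]]]]]]].
have [areaE _ _ areaO] := reg E redE minE dE.
have areaOi := areaO b w Omega tg tf i.
have areaOj := areaO b w Omega tg tf j.
have inj k l := @trace_faces_inj _ _ _ _ _ _ _ _ k l tg tf.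
have [cover comp bounds] := tf; have cov_arcs := trace_cover tg.
pose C := [set z | gaugeT u z <= 1]; pose S := [set z | gaugeT u z = 1].
have solidE : solid (sectors u) = C.
  by rewrite /solid (Y_points_sectors tu yY) convex_hull_tetra.
have bdryE : bdry (solid (sectors u)) = S by rewrite solidE; exact: bdry_sublevel.
have cE : closed E by case: minE.
rewrite bdryE in areaOi areaOj cover comp cov_arcs.
rewrite /delta bdryE solidE in areaE areaOi areaOj.
rewrite solidE in deff pqC.
have OSE k : Omega k `<=` S `\` E by rewrite cover; exact: bigcup_sup.
have cO k : closure (Omega k) `\` Omega k `<=` E.
  rewrite bounds => z [c [d [cd _ _ zcd]]].
  by have : (E `&` S) z; [rewrite cov_arcs; exists c, d|case].
(* Two components with a common point coincide, which [trace_faces_inj] excludes. *)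
have disj k l : k != l -> Omega k `&` Omega l = set0.
  move=> kl; apply/seteqP; split => // z [zk zl]; apply: (inj k l kl).
  move: zk zl; have [x _ ->] := comp k; have [x' _ ->] := comp l => zk zl.
  by rewrite (same_connected_component zk) (same_connected_component zl).
have conn k : connected (Omega k).
  by have [x _ ->] := comp k; exact: component_connected.
have [k [l ijkl]] := other_two ij.
have mO n := face_measurable cE (OSE n) (@cO n).
have TCfin := H2_sectors_solid tu.
have Sfin : (H2 S < +oo)%E.
  by apply: (le_lt_trans (H2_solid_bdry tu)); rewrite lte_add_pinfty.
have intm : exists2 m, segment p q m & gaugeT u m < 1.
  have [x _ Oi] := comp i; have [x' _ Oj] := comp j.
  have [/elipP lf fid _] := deff.
  apply: (@segment_hits_interior _ u E f x x') => //; rewrite -?Oi -?Oj//.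
  exact: inj.
have disjU A k' l' : k' != l' -> Omega k' `&` A = set0 ->
  Omega k' `&` (Omega l' `|` A) = set0.
  by move=> kl kA; rewrite setIUr disj// set0U.
move: (ijkl); rewrite /= !inE !negb_or => /and4P[/and3P[_ ik il] /andP[jk jl] kl _].
have SE : S `\` E = Omega i `|` (Omega j `|` (Omega k `|` Omega l)).
  rewrite cover; apply/seteqP; split => [z [n _ On]|z].
    have := mem_four ijkl n; rewrite !inE => /or4P[] /eqP e; rewrite e in On.
    - by left.
    - by right; left.
    - by right; right; left.
    - by right; right; right.
  by move=> [|[|[]]] Oz; [exists i|exists j|exists k|exists l].
have sumS : H2 S = (H2 (E `&` S) +
    (H2 (Omega i) + (H2 (Omega j) + (H2 (Omega k) + H2 (Omega l)))))%E.
  have := closed_caratheodory cE S; rewrite /H2o/= => ->; rewrite setIC; congr (_ + _)%E.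
  rewrite -setDE SE (H2_disjointU (mO i) (disjU _ _ _ ij (disjU _ _ _ ik (disj _ _ il)))).
  rewrite (H2_disjointU (mO j) (disjU _ _ _ jk (disj _ _ jl))).
  by rewrite (H2_disjointU (mO k) (disj _ _ kl)).
apply: (@area_contradiction R (H2 (sectors u `&` C)) (H2 S) (H2 (E `&` C))
  (H2 (E `&` S)) (H2 (Omega i)) (H2 (Omega j)) (H2 (Omega k)) (H2 (Omega l))) => //;
  rewrite ?H2_ge0//.
- exact: H2_solid_bdry.
- have [_ Efin _] := minE; apply: le_lt_trans (Efin 0 1 ltr01).
  by apply: le_H2 => z [Ez Cz]; split => //; exact: (compact_ball_gauge tu).
move=> e e0.
have [KA [cKA KAO smallA]] := face_inner_compact tu cE (OSE i) (@cO i) Sfin e0.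
have [KB [cKB KBO smallB]] := face_inner_compact tu cE (OSE j) (@cO j) Sfin e0.
apply: le_trans (competitor tu minE deff pqC intm (OSE i) (OSE j) (conn i) (conn j)
  Oip Ojq cKA cKB KAO KBO) _.
apply: leeD2l; have sub : S `\` E `\` (KA `|` KB) `<=`
    Omega k `|` (Omega l `|` ((Omega i `\` KA) `|` (Omega j `\` KB))).
  rewrite -/S SE => z [[Oz|[Oz|[Oz|Oz]]] /not_orP[nA nB]].
  - by right; right; left.
  - by right; right; right.
  - by left.
  - by right; left.
apply: le_trans (le_H2 sub) _.
do 2!(apply: le_trans (H2U _ _) _; apply: leeD2l).
by apply: le_trans (H2U _ _) _; apply: leeD.
Qed.
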